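(* Let $\mathcal A$ be a unital C$^*$-algebra, $\mathcal H$ a finitely or countably generated Hilbert $\mathcal A$-module, $J$ a finite or countable index set. Let $K,L\in Hom^*_{\mathcal A}(\mathcal H)$ with $R(L)\subseteq R(K)$ and $R(K)$ closed. Let $\{f_j\}_{j\in J}\subseteq\mathcal H$ be a $*$-$K$-frame with $*$-frame bounds $A,B\in\mathcal A$ and let $\{h_j\}_{j\in J}\subseteq\mathcal H$ be a sequence. If there exists a constant $M>0$ such that for every $f\in\mathcal H$ $$\Big\|\sum_{j\in J}\langle f,f_j-h_j\rangle\langle f_j-h_j,f\rangle\Big\|\le M\min\Big\{\Big\|\sum_{j\in J}\langle f,f_j\rangle\langle f_j,f\rangle\Big\|,\ \Big\|\sum_{j\in J}\langle f,h_j\rangle\langle h_j,f\rangle\Big\|\Big\},\qquad(\ast)$$ then $\{h_j\}_{j\in J}$ is a $*$-$L$-frame. Conversely, if in addition $K$ is a co-isometry, $R(K)\subseteq R(L)$ and $R(L)$ is closed, and if $\{h_j\}_{j\in J}$ is a $*$-$L$-frame, then there exists a constant $M>0$ such that $(\ast)$ holds for every $f\in\mathcal H$.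
   Context: Hilbert $\mathcal A$-modules are left modules with $\mathcal A$-valued inner product, $\mathcal A$-linear in the first variable; $\|f\|=\|\langle f,f\rangle\|^{1/2}$. $Hom^*_{\mathcal A}(\mathcal H)$ denotes the adjointable operators on $\mathcal H$ and $R(\cdot)$ denotes range. $K$ is a co-isometry if $KK^*=\mathrm{id}_{\mathcal H}$. An element of $\mathcal A$ is strictly nonzero if $0$ is not in its spectrum. For $K\in Hom^*_{\mathcal A}(\mathcal H)$, a sequence $\{f_j\}_{j\in J}\subseteq\mathcal H$ is a $*$-$K$-frame with (lower, upper) $*$-frame bounds $A,B$ if $A,B\in\mathcal A$ are strictly nonzero and $A\langle K^*f,K^*f\rangle A^*\le\sum_{j\in J}\langle f,f_j\rangle\langle f_j,f\rangle\le B\langle f,f\rangle B^*$ for all $f\in\mathcal H$, the sum converging in norm. In general the sums $\sum_j\langle f,g_j\rangle\langle g_j,f\rangle$ appearing are understood to converge in norm in $\mathcal A$. *)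

(* Defs.v *)
From HB Require Import structures.
From mathcomp Require Import all_boot all_order all_algebra.
From mathcomp Require Import complex finmap.
From mathcomp Require Import boolp classical_sets functions cardinality reals.
From mathcomp Require Import topology normedtype.
From mathcomp Require Import summability.

Set Implicit Arguments.
Unset Strict Implicit.
Unset Printing Implicit Defensive.

Import Order.TTheory GRing.Theory Num.Theory.
Import numFieldNormedType.Exports.

Local Open Scope classical_set_scope.
Local Open Scope complex_scope.
Local Open Scope ring_scope.

(* Scalars are R[i] with R : realType. Norms are R[i]-valued, as for every
   normedModType R[i]; in R[i], 0 <= z means that z is real and nonnegative. *)

Definition norm_complete (R : realType) (V : zmodType) (N : V -> R[i]) : Prop :=
  forall u : nat -> V,
    (forall e : R[i], 0 < e -> exists n0, forall m n,
       (n0 <= m)%N -> (n0 <= n)%N -> N (u m - u n) < e) ->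
    exists l : V, forall e : R[i], 0 < e -> exists n0, forall n,
       (n0 <= n)%N -> N (u n - l) < e.

(* The norm is a field of the mixin, and not inherited from normedModType,
   because the hierarchy has no join of rings with normed modules; the
   normedModType R[i] structure of a C*-algebra is declared below. *)
HB.mixin Record isCStarAlgebra (R : realType) A & GRing.Algebra R[i] A := {
  star : A -> A;
  cstar_norm : A -> R[i];
  starK : involutive star;
  starD : {morph star : a b / a + b};
  starZ : forall (c : R[i]) (a : A), star (c *: a) = Num.conj c *: star a;
  starM : forall a b : A, star (a * b) = star b * star a;
  cstar_normD : forall a b : A,
    cstar_norm (a + b) <= cstar_norm a + cstar_norm b;
  cstar_normZ : forall (c : R[i]) (a : A),
    cstar_norm (c *: a) = `|c| * cstar_norm a;
  cstar_norm0_eq0 : forall a : A, cstar_norm a = 0 -> a = 0;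
  cstar_normM : forall a b : A,
    cstar_norm (a * b) <= cstar_norm a * cstar_norm b;
  cstar_normX2 : forall a : A, cstar_norm (star a * a) = cstar_norm a ^+ 2;
  cstar_complete : norm_complete cstar_norm
}.

#[short(type="cstarAlgType")]
HB.structure Definition CStarAlgebra (R : realType) :=
  {A of GRing.Algebra R[i] A & isCStarAlgebra R A}.

HB.instance Definition _ (R : realType) (A : cstarAlgType R) :=
  Lmodule_isNormed.Build R[i] (CStarAlgebra.sort A)
    cstar_normD cstar_normZ cstar_norm0_eq0.

Section spectrum.
Context {R : realType} {A : cstarAlgType R}.

Definition cstar_invertible (a : A) : Prop :=
  exists b : A, b * a = 1 /\ a * b = 1.

Definition spectrum (a : A) : set R[i] :=
  [set c | ~ cstar_invertible (c%:A - a)].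

Definition strictly_nonzero (a : A) : Prop := ~ spectrum a 0.

Definition cstar_positive (a : A) : Prop :=
  star a = a /\ (forall c, spectrum a c -> 0 <= c).

Definition cstar_le (a b : A) : Prop := cstar_positive (b - a).

End spectrum.

(* The complex scalars act on a Hilbert A-module through c |-> c%:A.
   The field hilbert_normD (subadditivity of f |-> |<f,f>|^(1/2)) is not an
   extra requirement: it follows from the other ones by the Cauchy-Schwarz
   inequality for A-valued inner products. It is included only so that the
   library's normed structure can be declared on a Hilbert module below. *)
HB.mixin Record isHilbertModule (R : realType) (A : cstarAlgType R) H
    & GRing.Lmodule A H := {
  inner : H -> H -> A;
  inner_linearl : forall (a : A) (f g h : H),
    inner (a *: f + g) h = a * inner f h + inner g h;
  inner_star : forall f g : H, star (inner f g) = inner g f;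
  inner_ge0 : forall f : H, cstar_positive (inner f f);
  inner_eq0 : forall f : H, inner f f = 0 -> f = 0;
  hilbert_normD : forall f g : H,
    sqrtC `|inner (f + g) (f + g)|
      <= sqrtC `|inner f f| + sqrtC `|inner g g|;
  hilbert_complete : norm_complete (fun f : H => sqrtC `|inner f f|)
}.

#[short(type="hilbertModType")]
HB.structure Definition HilbertModule (R : realType) (A : cstarAlgType R) :=
  {H of GRing.Lmodule A H & isHilbertModule R A H}.

Section hilbert_norm.
Context {R : realType} {A : cstarAlgType R} {H : hilbertModType A}.

Definition hilbert_norm (f : H) : R[i] := sqrtC `|inner f f|.

Lemma hilbert_norm0_eq0 (f : H) : hilbert_norm f = 0 -> f = 0.
Proof. by move/eqP; rewrite sqrtC_eq0 normr_eq0 => /eqP /inner_eq0. Qed.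

Lemma innerDl (f h g : H) : inner (f + h) g = inner f g + inner h g.
Proof. by have := inner_linearl 1 f h g; rewrite scale1r mul1r. Qed.

Lemma inner0l (g : H) : inner 0 g = 0.
Proof. by apply: (addrI (inner 0 g)); rewrite -innerDl !addr0. Qed.

Lemma innerMnl (f g : H) n : inner (f *+ n) g = inner f g *+ n.
Proof. by elim: n => [|n IH]; rewrite ?inner0l// !mulrS innerDl IH. Qed.

Lemma innerNl (f g : H) : inner (- f) g = - inner f g.
Proof. by apply: (addrI (inner f g)); rewrite -innerDl !subrr inner0l. Qed.

Lemma star_opp (a : A) : star (- a) = - star a.
Proof. by rewrite -scaleN1r starZ rmorphN rmorph1 scaleN1r. Qed.

Lemma starMn (a : A) n : star (a *+ n) = star a *+ n.
Proof. by rewrite -scaler_nat starZ rmorph_nat scaler_nat. Qed.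

Lemma hilbert_normMn (f : H) n : hilbert_norm (f *+ n) = hilbert_norm f *+ n.
Proof.
rewrite /hilbert_norm innerMnl -inner_star innerMnl starMn inner_star.
rewrite !normrMn -mulrnA -(mulr_natr _ (n * n)) natrM -expr2.
by rewrite sqrtCM ?qualifE /= ?normr_ge0 ?exprn_ge0 ?ler0n// sqrCK ?ler0n// mulr_natr.
Qed.

Lemma hilbert_normN (f : H) : hilbert_norm (- f) = hilbert_norm f.
Proof.
by rewrite /hilbert_norm innerNl -inner_star innerNl star_opp inner_star opprK.
Qed.

End hilbert_norm.

HB.instance Definition _ (R : realType) (A : cstarAlgType R)
    (H : hilbertModType A) :=
  Num.Zmodule_isNormed.Build R[i] (HilbertModule.sort H)
    (@hilbert_normD R A H) (@hilbert_norm0_eq0 R A H)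
    (@hilbert_normMn R A H) (@hilbert_normN R A H).
HB.instance Definition _ (R : realType) (A : cstarAlgType R)
    (H : hilbertModType A) :=
  PseudoMetric.copy (HilbertModule.sort H)
    (pseudoMetric_normed (HilbertModule.sort H)).
HB.instance Definition _ (R : realType) (A : cstarAlgType R)
    (H : hilbertModType A) := isPointed.Build (HilbertModule.sort H) 0.
HB.instance Definition _ (R : realType) (A : cstarAlgType R)
    (H : hilbertModType A) :=
  NormedZmod_PseudoMetric_eq.Build R[i] (HilbertModule.sort H) erefl.

Section hilbert_modules.
Context {R : realType} {A : cstarAlgType R}.

Definition lspan {H : hilbertModType A} (G : set H) : set H :=
  [set x | exists (n : nat) (g : 'I_n -> H) (a : 'I_n -> A),
    (forall i, G (g i)) /\ x = \sum_(i < n) a i *: g i].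

Definition finitely_generated (H : hilbertModType A) : Prop :=
  exists G : set H, finite_set G /\ lspan G = setT.

Definition countably_generated (H : hilbertModType A) : Prop :=
  exists G : set H, countable G /\ closure (lspan G) = setT.

(* The adjoint is determined by the operator; A-linearity and boundedness of
   the operator follow from adj_inner. *)
Record adjointable (H : hilbertModType A) := Adjointable {
  adj_fun :> H -> H;
  adj : H -> H;
  adj_inner : forall f g : H, inner (adj_fun f) g = inner f (adj g)
}.

Definition co_isometry (H : hilbertModType A) (K : adjointable H) : Prop :=
  forall f : H, K (adj K f) = f.

End hilbert_modules.

Section frames.
Context {R : realType} {A : cstarAlgType R} {H : hilbertModType A}.
Context {J : countType}.

Definition frame_term (g : J -> H) (f : H) (j : J) : A :=
  inner f (g j) * inner (g j) f.

(* Norm convergence along the net of finite subsets of J; as the terms are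
   positive, this is convergence of the series for any enumeration of J. *)
Definition frame_cvg (g : J -> H) (f : H) : Prop :=
  cvg (partial_sum (frame_term g f) @ totally).

Definition frame_sum (g : J -> H) (f : H) : A := sum (frame_term g f).

Definition star_frame_bounds (K : adjointable H) (g : J -> H) (a b : A) : Prop :=
  [/\ strictly_nonzero a, strictly_nonzero b &
   forall f : H,
    [/\ frame_cvg g f,
        cstar_le (a * inner (adj K f) (adj K f) * star a) (frame_sum g f) &
        cstar_le (frame_sum g f) (b * inner f f * star b)]].

Definition is_star_frame (K : adjointable H) (g : J -> H) : Prop :=
  exists a b : A, star_frame_bounds K g a b.

Definition perturbation_bound (g h : J -> H) (M : R) : Prop :=
  forall f : H,
    [/\ frame_cvg g f, frame_cvg h f, frame_cvg (fun j => g j - h j) f &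
     `|frame_sum (fun j => g j - h j) f|
       <= M%:C * Num.min `|frame_sum g f| `|frame_sum h f|].

End frames.

(* Main.v *)
(* Positivity in a C*-algebra, defined by the spectrum, is first compared with
   the norm condition [exists T, `|T - x| <= T], which is visibly stable under
   sums and limits. For such an [x] and [e > 0] the element [x + e] has a square
   root, given by a contracting iteration. If [x] is self-adjoint and all
   [x + t], [t > 0], are invertible, then the set of the [t >= 0] such that
   [x + t] satisfies the norm condition is closed, and it is open to the left
   at [t > 0], so it contains [0]; neither the spectral radius formula nor
   complex analysis is needed.

   Let [p] and [q] be positive quadratic maps [H -> A] with
   [p (c f) = c (p f) c*], and the same for [q]. If [`|p f| <= C `|q f|] for all
   [f], then [p f <= C (q f)]: apply the norm inequality to [c f] with
   [c = (q f + e)^(-1/2)]. Hence everything reduces to inequalities between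
   norms. Those follow from the parallelogram bound
   [|x - y|^2 <= 2 |x|^2 + 2 |y|^2] for the sums, and from the uniform
   boundedness principle: if [range L `<=` range K], then the [L* f] with
   [`|K* f| <= 1] form a weakly bounded set, so [`|L* f| <= C `|K* f|]. *)
Require Import Defs.
From mathcomp Require Import all_boot all_order all_algebra.
From mathcomp Require Import boolp classical_sets reals topology normedtype.
From mathcomp Require Import complex finmap sequences summability.
From mathcomp Require Import ring lra.
From Stdlib Require Ncring Ncring_tac.

Set Implicit Arguments.
Unset Strict Implicit.
Unset Printing Implicit Defensive.

Import Order.TTheory GRing.Theory Num.Theory.
Import numFieldNormedType.Exports.

Local Open Scope classical_set_scope.
Local Open Scope complex_scope.
Local Open Scope ring_scope.

(** * Identities in noncommutative rings *)

Section noncommutative_ring_tactic.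
Context {T : pzRingType}.

(** Registers the operations of a [pzRingType] with the Stdlib class behind [ncring], which then
    normalizes identities in [A]. *)
Definition pzRing_ops :
  @Ncring.Ring_ops T 0 1 +%R *%R (fun x y => x - y) -%R eq.
Proof. by constructor. Defined.

#[local] Existing Instance pzRing_ops.

Lemma pzRing_ncring : Ncring.Ring (Ro := pzRing_ops).
Proof.
split; try exact _; rewrite /=.
- exact: add0r.
- exact: addrC.
- exact: addrA.
- exact: mul1r.
- exact: mulr1.
- exact: mulrA.
- by move=> x y z; exact: mulrDl.
- by move=> x y z; exact: mulrDr.
- by [].
- exact: subrr.
Qed.

End noncommutative_ring_tactic.

#[local] Existing Instance pzRing_ops.
#[local] Existing Instance pzRing_ncring.
#[local] Existing Instance totally_filter.

Ltac ncring := Ncring_tac.non_commutative_ring.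

(** * Elementary real estimates *)

Section real_lemmas.
Context {R : realType}.
Implicit Types (q e x y : R).

Lemma exists_expr_lt q e : 0 <= q < 1 -> 0 < e -> exists n, q ^+ n < e.
Proof.
move=> /andP[q0 q1] e0.
have /cvg_expr/cvgrPdist_lt/(_ _ e0)[N _ HN] : `|q| < 1 by rewrite ger0_norm.
exists N; have := HN N (leqnn N).
by rewrite sub0r normrN ger0_norm // exprn_ge0.
Qed.

(** The usual tolerance: an error [e / (x + 1)] amplified by [x] stays below [e], with [x = 0]
    allowed. *)
Lemma divr_mul_lt e x : 0 < e -> 0 <= x -> e / (x + 1) * x < e.
Proof.
by move=> e0 x0; rewrite mulrAC ltr_pdivrMr ?ltr_wpDl // ltr_pM2l // ltrDl.
Qed.

End real_lemmas.

(** * The real-valued norm, real scalars and contractions *)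

Section norm.
Context {R : realType} {A : cstarAlgType R}.
Implicit Types (a b x y z u : A) (r s t e : R).

(* The norms of Defs are R[i]-valued; [nm] and [hn] are their real versions. *)
Definition nm a : R := complex.Re `|a|.

Lemma normE a : `|a| = (nm a)%:C.
Proof. by rewrite /nm RRe_real // normr_real. Qed.

Lemma nm_ge0 a : 0 <= nm a.
Proof. by rewrite -ler0c -normE normr_ge0. Qed.

Lemma nm_eq0 a : nm a = 0 -> a = 0.
Proof. by move=> h; apply/normr0_eq0; rewrite normE h. Qed.

Lemma nm0 : nm (0 : A) = 0.
Proof. by rewrite /nm normr0. Qed.

Lemma nmN a : nm (- a) = nm a.
Proof. by rewrite /nm normrN. Qed.

Lemma nm_distC a b : nm (a - b) = nm (b - a).
Proof. by rewrite -nmN opprB. Qed.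

Lemma nmD a b : nm (a + b) <= nm a + nm b.
Proof. by rewrite -lecR rmorphD /= -!normE ler_normD. Qed.

Lemma nmB a b : nm (a - b) <= nm a + nm b.
Proof. by rewrite -[nm b]nmN nmD. Qed.

Lemma nm_triangle b a c : nm (a - c) <= nm (a - b) + nm (b - c).
Proof. by have -> : a - c = (a - b) + (b - c); [ncring | exact: nmD]. Qed.

Lemma nmM a b : nm (a * b) <= nm a * nm b.
Proof. by rewrite -lecR rmorphM /= -!normE; exact: cstar_normM. Qed.

Lemma nmZ (c : R[i]) a : nm (c *: a) = complex.Re `|c| * nm a.
Proof.
apply/complexI; rewrite rmorphM -!normE normrZ; congr (_ * _).
exact/esym/RRe_real/normr_real.
Qed.

Lemma nm_starM a : nm (star a * a) = nm a ^+ 2.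
Proof.
apply/complexI; rewrite rmorphXn /= -!normE; exact: cstar_normX2.
Qed.

(** The C*-identity and submultiplicativity give [nm b ^+ 2 <= nm (star b) * nm b]; cancel [nm b],
    then use this for both [a] and [star a]. *)
Lemma nm_star a : nm (star a) = nm a.
Proof.
have le b : nm b <= nm (star b).
  have := nm_starM b; have := nmM (star b) b; have := nm_ge0 b.
  have := nm_ge0 (star b); move: (nm b) (nm (star b)) (nm _) => p q s.
  move=> q0 p0 h1 h2; rewrite h2 expr2 in h1.
  case: (ltP 0 p) => [p1|]; last by move=> p1; lra.
  by move: h1; rewrite ler_pM2r.
by apply/eqP; rewrite eq_le le -{2}[a]starK le.
Qed.

Lemma nm_Mstar a : nm (a * star a) = nm a ^+ 2.
Proof. by rewrite -{1}[a]starK nm_starM nm_star. Qed.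

Lemma star0 : star (0 : A) = 0.
Proof. by apply: (addrI (star 0)); rewrite -starD !addr0. Qed.

Lemma starB a b : star (a - b) = star a - star b.
Proof. by rewrite starD star_opp. Qed.

Lemma star1 : star (1 : A) = 1.
Proof. by rewrite -[LHS]mulr1 -{2}[1]starK -starM mulr1 starK. Qed.

Lemma nm1 : nm (1 : A) = 1.
Proof.
have := nm_starM 1; rewrite star1 mulr1 expr2 => h.
have n0 : nm (1 : A) != 0.
  by apply/eqP => /nm_eq0 /eqP; rewrite oner_eq0.
by apply: (mulfI n0); rewrite mulr1.
Qed.

Definition rs r : A := r%:C%:A.

Lemma rsD r s : rs (r + s) = rs r + rs s.
Proof. by rewrite /rs rmorphD scalerDl. Qed.

Lemma rsN r : rs (- r) = - rs r.
Proof. by rewrite /rs rmorphN scaleNr. Qed.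

Lemma rsB r s : rs (r - s) = rs r - rs s.
Proof. by rewrite rsD rsN. Qed.

Lemma rsM r s : rs (r * s) = rs r * rs s.
Proof. by rewrite /rs rmorphM -scalerAl mul1r scalerA. Qed.

Lemma rs0 : rs 0 = 0. Proof. by rewrite /rs rmorph0 scale0r. Qed.
Lemma rs1 : rs 1 = 1. Proof. by rewrite /rs rmorph1 scale1r. Qed.

(** For [ncring] the scalar [rs r] is an ordinary ring element, so identities below display
    commutators such as [k * rs d - rs d * k], which this lemma removes. *)
Lemma rsC r a : rs r * a = a * rs r.
Proof. by rewrite /rs -scalerAl -scalerAr mul1r mulr1. Qed.

Lemma star_rs r : star (rs r) = rs r.
Proof.
rewrite /rs starZ star1; congr (_ *: _).
by apply/CrealP; rewrite complex_real.
Qed.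

Lemma nm_rsM r a : nm (rs r * a) = `|r| * nm a.
Proof.
rewrite /rs -scalerAl mul1r nmZ; congr (_ * _).
by rewrite normc_def /= expr0n /= addr0 sqrtr_sqr.
Qed.

Lemma nm_rs r : nm (rs r) = `|r|.
Proof. by rewrite -[rs r]mulr1 nm_rsM nm1 mulr1. Qed.

Lemma rsVl r : r != 0 -> rs r^-1 * rs r = 1.
Proof. by move=> r0; rewrite -rsM mulVf // rs1. Qed.

Lemma rsVr r : r != 0 -> rs r * rs r^-1 = 1.
Proof. by move=> r0; rewrite -rsM mulfV // rs1. Qed.

Lemma nm_complete (u : nat -> A) :
  (forall e, 0 < e -> exists n0, forall m n, (n0 <= m)%N -> (n0 <= n)%N ->
     nm (u m - u n) < e) ->
  exists l, forall e, 0 < e -> exists n0, forall n, (n0 <= n)%N ->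
     nm (u n - l) < e.
Proof.
have conv (a : A) (e : R[i]) :
    0 < e -> (cstar_norm a < e) = (nm a < complex.Re e).
  move=> e0; rewrite -[e]RRe_real ?gtr0_real //= -ltcR -normE //.
move=> hu; have [e e0|l hl] := @cstar_complete R A u.
  have [|n0 hn] := hu (complex.Re e).
    by move: e0; rewrite ltcE => /andP[].
  by exists n0 => m n hm hk; rewrite conv // hn.
exists l => e e0; have [|n0 hn] := hl e%:C; first by rewrite ltcR.
by exists n0 => n hk; have := hn n hk; rewrite conv // ltcR.
Qed.

Lemma nm_small_eq0 a : (forall e, 0 < e -> nm a <= e) -> a = 0.
Proof.
move=> h; apply: nm_eq0; apply/eqP; rewrite eq_le nm_ge0 andbT.
by apply/ler_addgt0Pr => e e0; rewrite add0r h.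
Qed.

(** Banach's fixed point theorem on a closed invariant set. The predicate [S] carries the properties
    that the fixed point must inherit from the iterates. *)
Lemma contraction_fixpoint (S : A -> Prop) (T : A -> A) (q : R) x0 :
  0 <= q < 1 -> S x0 -> (forall x, S x -> S (T x)) ->
  (forall x y, S x -> S y -> nm (T x - T y) <= q * nm (x - y)) ->
  (forall l, (forall e, 0 < e -> exists2 y, S y & nm (y - l) < e) -> S l) ->
  exists2 l, S l & T l = l.
Proof.
move=> /andP[q0 q1] S0 ST cT clS.
pose u n := iter n T x0; pose d := nm (u 1%N - u 0%N).
have Su n : S (u n) by elim: n => // n IH; exact: ST.
have du n : nm (u n.+1 - u n) <= q ^+ n * d.
  elim: n => [|n IH]; first by rewrite mul1r.
  apply: (le_trans (cT (u n.+1) (u n) (Su _) (Su _))).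
  by rewrite exprS -mulrA ler_wpM2l.
have d0 : 0 <= d by exact: nm_ge0.
(* The geometric sum, multiplied by [1 - q] so that the induction telescopes without division. *)
have tail n k : (1 - q) * nm (u (n + k)%N - u n) <= (q ^+ n - q ^+ (n + k)) * d.
  elim: k => [|k IH]; first by rewrite addn0 !subrr nm0 mulr0 mul0r.
  rewrite addnS; have := nm_triangle (u (n + k)%N) (u (n + k).+1) (u n).
  have := du (n + k)%N; rewrite exprS; move: IH.
  move: (nm _) (nm _) (nm _) (q ^+ n) (q ^+ (n + k)) => x y z p r.
  by move=> *; nra.
have tail' n m : (n <= m)%N -> (1 - q) * nm (u m - u n) <= q ^+ n * d.
  move=> nm_le; rewrite -(subnKC nm_le).
  apply: le_trans (tail n (m - n)%N) _.
  by apply: ler_wpM2r => //; rewrite gerBl exprn_ge0.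
have small e : 0 < e -> exists n0, forall n, (n0 <= n)%N -> nm (u n - u n0) < e.
  move=> e0.
  have e1 : 0 < (1 - q) * e / (d + 1) by apply: divr_gt0; nra.
  have [|n0 hn] := @exists_expr_lt R q _ _ e1; first by rewrite q0.
  exists n0 => n /tail' h.
  have {}hn : q ^+ n0 * (d + 1) < (1 - q) * e by rewrite -ltr_pdivlMr //; lra.
  have := exprn_ge0 n0 q0; move: h hn.
  by move: (nm _) (q ^+ _) => x y *; nra.
have [e e0|l hl] := @nm_complete u.
  have [|n0 hn] := small (e / 2); first lra.
  exists n0 => m n /hn hm /hn hk.
  apply: le_lt_trans (nm_triangle (u n0) _ _) _.
  by rewrite [X in _ + X]nm_distC; lra.
have Sl : S l.
  apply: clS => e e0; have [n0 hn] := hl e e0.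
  by exists (u n0) => //; exact: hn.
exists l => //; apply/eqP; rewrite -subr_eq0; apply/eqP.
apply: nm_small_eq0 => e e0.
have [|n0 hn] := hl (e / 2); first lra.
have := nm_triangle (u n0.+1) (T l) l.
have := hn n0.+1 (leqnSn _).
have := hn n0 (leqnn _); rewrite nm_distC => h1 h2.
have := cT _ _ Sl (Su n0); rewrite -/(u n0.+1).
move: h1 h2; rewrite -/(u n0.+1) /=.
have := nm_ge0 (l - u n0).
move: (nm (l - u n0)) (nm (T l - _)) (nm (_ - l)) (nm _) => x y z w *.
by nra.
Qed.

End norm.

(** * Square roots and the norm condition for positivity *)

Section positivity.
Context {R : realType} {A : cstarAlgType R}.
Implicit Types (a b c k x y z u v w r s : A) (t e d T : R).

Lemma cstar_invertible_lr a x y :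
  x * a = 1 -> a * y = 1 -> cstar_invertible a.
Proof.
move=> xa ay; have xy : x = y by rewrite -[x]mulr1 -ay mulrA xa mul1r.
by exists y; split=> //; rewrite -xy.
Qed.

Lemma cstar_invertibleN a : cstar_invertible a -> cstar_invertible (- a).
Proof. by move=> [b [h1 h2]]; exists (- b); rewrite !mulrNN. Qed.

Lemma cstar_invertible_rsM t a :
  t != 0 -> cstar_invertible a -> cstar_invertible (rs t * a).
Proof.
move=> t0 [b [h1 h2]]; exists (b * rs t^-1); split.
  by rewrite -mulrA [rs _ * (_ * _)]mulrA rsVl // mul1r.
by rewrite -mulrA [a * _]mulrA h2 mul1r rsVr.
Qed.

Lemma cstar_invertible_factor a b :
  a * b = b * a -> cstar_invertible (a * b) -> cstar_invertible a.
Proof.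
move=> ab [k [h1 h2]]; apply: (@cstar_invertible_lr _ (k * b) (b * k)).
  by rewrite -mulrA -ab.
by rewrite mulrA.
Qed.

Lemma comm_inverse a b c : a * b = 1 -> b * a = 1 -> c * a = a * c ->
  c * b = b * c.
Proof.
move=> ab ba ca.
by rewrite -[LHS]mul1r -ba -mulrA [a * _]mulrA -ca -[c * a * b]mulrA ab mulr1.
Qed.

Lemma star_inverse a b : a * b = 1 -> b * a = 1 -> star a = a -> star b = b.
Proof.
move=> ab ba sa; have h : star b * a = 1 by rewrite -sa -starM ab star1.
by rewrite -[star b]mulr1 -ab mulrA h mul1r.
Qed.

(** In place of the Neumann series: a fixed point of [y |-> 1 + u * y] is a right inverse of
    [1 - u], and one of [y |-> 1 + y * u] is a left inverse. *)
Lemma cstar_invertible_1B u : nm u < 1 -> cstar_invertible (1 - u).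
Proof.
move=> u1.
have q01 : 0 <= nm u < 1 by rewrite nm_ge0.
have [|||y _ hy] :=
  @contraction_fixpoint R A (fun=> True) (fun y => 1 + u * y) _ 0 q01 I.
- by [].
- move=> x y _ _; have -> : 1 + u * x - (1 + u * y) = u * (x - y) by ncring.
  exact: nmM.
- by [].
have [|||x _ hx] :=
  @contraction_fixpoint R A (fun=> True) (fun y => 1 + y * u) _ 0 q01 I.
- by [].
- move=> x y' _ _; have -> : 1 + x * u - (1 + y' * u) = (x - y') * u by ncring.
  by rewrite mulrC; exact: nmM.
- by [].
apply: (@cstar_invertible_lr _ x y).
  by rewrite mulrBr mulr1 -{1}hx addrK.
by rewrite mulrBl mul1r -{1}hy addrK.
Qed.

Lemma selfadjoint_closed l :
  (forall e, 0 < e -> exists2 y : A, star y = y & nm (y - l) < e) -> star l = l.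
Proof.
move=> h; apply/eqP; rewrite -subr_eq0; apply/eqP/nm_small_eq0 => e e0.
have [|y sy hy] := h (e / 2); first lra.
have -> : star l - l = (y - l) - star (y - l) by rewrite starB sy; ncring.
by apply: le_trans (nmB _ _) _; rewrite nm_star; lra.
Qed.

Lemma comm_closed c l :
  (forall e, 0 < e -> exists2 y : A, c * y = y * c & nm (y - l) < e) ->
  c * l = l * c.
Proof.
move=> h; apply/eqP; rewrite -subr_eq0; apply/eqP/nm_small_eq0 => e e0.
have c0 := nm_ge0 c.
have [|y sy hy] := h (e / (2 * nm c + 1)); first by apply: divr_gt0; lra.
have -> : c * l - l * c = (y - l) * c - c * (y - l) + (c * y - y * c) by ncring.
rewrite sy subrr addr0.
have := nmB ((y - l) * c) (c * (y - l)).
have := nmM (y - l) c; have := nmM c (y - l); have := nm_ge0 (y - l).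
move: hy; rewrite ltr_pdivlMr; last lra.
move: (nm (_ - _ * _)) (nm (_ * c)) (nm (c * _)) (nm (y - l)) (nm c) c0.
by move=> n1 n2 n3 n4 n5 *; nra.
Qed.

(* Equivalent to [cstar_positive x], see [cstar_positiveE]. *)
Definition npos x : Prop := star x = x /\ exists T, nm (rs T - x) <= T.

Lemma npos_sa x : npos x -> star x = x. Proof. by case. Qed.

(** With [u = 1 - x] and [r = 1 - y], the equation [r * r = x] becomes [y = (u + y * y) / 2]. The
    right side is a contraction of ratio [q = nm u] on the ball of radius [q]; [S] adds
    self-adjointness and commutation with the commutant of [x]. *)
Lemma sqrt_near1 x : star x = x -> nm (1 - x) < 1 ->
  exists r, [/\ star r = r, r * r = x, nm (1 - r) < 1 &
    forall c, c * x = x * c -> c * r = r * c].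
Proof.
move=> sx x1; pose u := 1 - x; pose q := nm u.
have q0 : 0 <= q by exact: nm_ge0.
pose S y := [/\ star y = y, nm y <= q &
                forall c, c * x = x * c -> c * y = y * c].
have half : rs 2^-1 + rs 2^-1 = 1 :> A by rewrite -rsD -[RHS]rs1; congr rs; lra.
have S0 : S 0 by split=> [||c _]; rewrite ?star0 ?nm0 ?mulr0 ?mul0r.
have q01 : 0 <= q < 1 by rewrite q0.
have [y|y z|l hl|y [sy qy cy] hy] :=
  @contraction_fixpoint R A S (fun y => rs 2^-1 * (u + y * y)) q _ q01 S0.
- move=> [sy qy cy]; split.
  + by rewrite starM star_rs starD starM sy /u starB star1 sx rsC.
  + rewrite nm_rsM ger0_norm; last lra.
    have := nmD u (y * y); have := nmM y y; have := nm_ge0 y.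
    rewrite -/q in x1 *; move: (nm (_ + _)) (nm (_ * _)) (nm y) qy.
    by move=> *; nra.
  + move=> c cx; rewrite mulrA -rsC -!mulrA; congr (_ * _).
    rewrite mulrDr mulrDl mulrA (cy c cx) -mulrA (cy c cx) mulrA.
    congr (_ + _).
    by rewrite /u mulrBr mulrBl mulr1 mul1r cx.
- move=> [_ qy _] [_ qz _].
  have -> : rs 2^-1 * (u + y * y) - rs 2^-1 * (u + z * z) =
            rs 2^-1 * (y * (y - z) + (y - z) * z) by ncring.
  rewrite nm_rsM ger0_norm; last lra.
  have := nmD (y * (y - z)) ((y - z) * z).
  have := nmM y (y - z); have := nmM (y - z) z; have := nm_ge0 (y - z).
  move: (nm (_ + _)) (nm (y * _)) (nm (_ * z)) (nm (y - z)) (nm y) (nm z) qy qz.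
  by move=> *; nra.
- split.
  + by apply: selfadjoint_closed => e /hl[y [sy _ _] hy]; exists y.
  + apply/ler_addgt0Pr => e /hl[y [_ qy _] hy].
    by have := nm_triangle y l 0; rewrite !subr0 nm_distC; lra.
  + move=> c cx; apply: comm_closed => e /hl[y [_ _ cy] hy].
    by exists y => //; exact: cy.
have yy : y + y = u + y * y.
  by rewrite -{1 2}hy -mulrDl half mul1r.
exists (1 - y); split.
- by rewrite starB star1 sy.
- have -> : (1 - y) * (1 - y) = 1 - (y + y) + y * y by ncring.
  by rewrite yy /u; ncring.
- have -> : 1 - (1 - y) = y by ncring.
  exact: le_lt_trans qy x1.
- by move=> c cx; rewrite mulrBr mulrBl mulr1 mul1r cy.
Qed.

(** Rescaling: [x / T] is at distance less than 1 from 1, and its root is multiplied by the square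
    root of [T]. *)
Lemma cstar_sqrt x T : star x = x -> nm (rs T - x) < T ->
  exists r, [/\ npos r, r * r = x &
    forall c, c * x = x * c -> c * r = r * c].
Proof.
move=> sx hT.
have T0 : 0 < T by apply: le_lt_trans hT; exact: nm_ge0.
have [||r [sr rr r1 cr]] := @sqrt_near1 (rs T^-1 * x).
- by rewrite starM sx star_rs rsC.
- have -> : 1 - rs T^-1 * x = rs T^-1 * (rs T - x).
    by rewrite mulrBr rsVl ?lt0r_neq0.
  rewrite nm_rsM gtr0_norm ?invr_gt0 // mulrC ltr_pdivrMr //; lra.
have s0 : 0 < Num.sqrt T by rewrite sqrtr_gt0.
exists (rs (Num.sqrt T) * r); split.
- split; first by rewrite starM sr star_rs rsC.
  exists (Num.sqrt T).
  have -> : rs (Num.sqrt T) - rs (Num.sqrt T) * r = rs (Num.sqrt T) * (1 - r).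
    by ncring.
  by rewrite nm_rsM gtr0_norm // ler_piMr ?ltW.
- rewrite -mulrA [r * _]mulrA -rsC -!mulrA rr !mulrA -rsM -expr2 sqr_sqrtr.
    by rewrite rsVr ?mul1r ?lt0r_neq0.
  exact: ltW.
- move=> c cx; rewrite mulrA -rsC -!mulrA cr //.
  by rewrite mulrA -rsC -!mulrA cx.
Qed.

(** Replacing [x] and [T] by [x + e] and [T + e] keeps their difference, so the norm condition
    becomes strict. *)
Lemma npos_sqrt x e : npos x -> 0 < e ->
  exists r, [/\ npos r, r * r = x + rs e &
    forall c, c * x = x * c -> c * r = r * c].
Proof.
move=> [sx [T hT]] e0.
have [||r [h1 h2 h3]] := @cstar_sqrt (x + rs e) (T + e).
- by rewrite starD sx star_rs.
- have -> : rs (T + e) - (x + rs e) = rs T - x by rewrite rsD; ncring.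
  lra.
exists r; split=> // c cx; apply: h3.
by rewrite mulrDr mulrDl cx rsC.
Qed.

Lemma npos_sqrt_compl x T : star x = x -> nm x < T ->
  exists v, [/\ npos v, v * v = rs T - x &
    forall c, c * x = x * c -> c * v = v * c].
Proof.
move=> sx xT; have [||v [h1 h2 h3]] := @cstar_sqrt (rs T - x) T.
- by rewrite starB sx star_rs.
- by have -> : rs T - (rs T - x) = x by ncring.
by exists v; split=> // c cx; apply: h3; rewrite mulrBr mulrBl cx rsC.
Qed.

(** Factor [x + e] as [T + e] times [1 - (T - x) / (T + e)], where the subtracted term has norm at
    most [T / (T + e) < 1]. *)
Lemma npos_addr_invertible x e :
  npos x -> 0 < e -> cstar_invertible (x + rs e).
Proof.
move=> [sx [T hT]] e0; have T0 : 0 <= T by apply: le_trans hT; exact: nm_ge0.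
have Te : T + e != 0 by rewrite lt0r_neq0 //; lra.
have -> : x + rs e = rs (T + e) * (1 - rs (T + e)^-1 * (rs T - x)).
  by rewrite mulrBr mulrA rsVr // mul1r mulr1 rsD; ncring.
apply: cstar_invertible_rsM => //; apply: cstar_invertible_1B.
rewrite nm_rsM gtr0_norm ?invr_gt0 //; last lra.
by rewrite mulrC ltr_pdivrMr; lra.
Qed.

(* [u = w + i v] satisfies [u u* = T], so [w], its real part, has norm at
   most [sqrt T]. *)
Lemma nm_sqr_le_of_sum_sqr w v T : 0 <= T -> star w = w -> star v = v ->
  w * v = v * w -> w * w + v * v = rs T -> nm (w * w) <= T.
Proof.
move=> T0 sw sv wv wvT; pose i : A := 'i%:A; pose u := w + i * v.
have iC a : i * a = a * i by rewrite /i -scalerAl -scalerAr mul1r mulr1.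
have ii : i * i = -1.
  by rewrite /i -scalerAl mul1r scalerA -expr2 sqrCi scaleN1r.
have si : star i = - i.
  rewrite /i starZ star1 -scaleNr; congr (_ *: _).
  exact: conjCi.
have su : star u = w - i * v by rewrite /u starD starM sw sv si iC mulrN.
have uu : u * star u = rs T.
  rewrite su /u -wvT.
  have -> : (w + i * v) * (w - i * v) =
     w * w - (w * i - i * w) * v - i * (w * v - v * w)
     + i * (i * v - v * i) * v - i * i * (v * v) by ncring.
  by rewrite -iC wv -iC !subrr ii; ncring.
have uT : nm u ^+ 2 = T by rewrite -nm_Mstar uu nm_rs ger0_norm.
have -> : w * w = star w * w by rewrite sw.
rewrite nm_starM -uT ler_sqr ?nnegrE ?nm_ge0 //.
have -> : w = rs 2^-1 * (u + star u).
  have -> : u + star u = rs 2 * w.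
    by rewrite su /u (rsD 1 1) rs1; ncring.
  by rewrite mulrA rsVl ?mul1r // pnatr_eq0.
rewrite nm_rsM ger0_norm; last lra.
by have := nmD u (star u); rewrite nm_star; lra.
Qed.

(** For [T = nm (w * w) + 1] let [v] be the root of [T - w * w]. It commutes with [w] and the two
    squares add up to [T], so the preceding bound, applied to [v], gives the norm condition with
    witness [T]. *)
Lemma npos_sqr w : star w = w -> npos (w * w).
Proof.
move=> sw; have sww : star (w * w) = w * w by rewrite starM sw.
split=> //; exists (nm (w * w) + 1).
have [|v [nv vv cv]] := @npos_sqrt_compl (w * w) (nm (w * w) + 1) sww.
  by lra.
rewrite -vv; apply: (@nm_sqr_le_of_sum_sqr v w) => //.
- by have := nm_ge0 (w * w); lra.
- by case: nv.
- by rewrite cv // mulrA.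
- by rewrite vv subrK.
Qed.

(** The witness in [npos] can thus be any bound of the norm, which makes it uniform on bounded sets.
    As for squares, apply the bound on sums of two squares to a root [r] of [x + e] and a root [v]
    of [T + 2 e - r * r]. *)
Lemma npos_nm x T : npos x -> nm x <= T -> nm (rs T - x) <= T.
Proof.
move=> px xT; apply/ler_addgt0Pr => e' e'0.
pose e := e' / 3; have e0 : 0 < e by rewrite /e; lra.
have [r [nr rr _]] := npos_sqrt px e0.
have nrr : nm (r * r) <= T + e.
  by rewrite rr; apply: le_trans (nmD _ _) _; rewrite nm_rs gtr0_norm //; lra.
have [||v [nv vv cv]] := @npos_sqrt_compl (r * r) (T + e + e).
- by rewrite starM npos_sa.
- by lra.
have := @nm_sqr_le_of_sum_sqr v r (T + e + e) _ (npos_sa nv) (npos_sa nr).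
rewrite -cv ?mulrA // vv subrK => /(_ _ erefl erefl) h.
have -> : rs T - x = rs (T + e + e) - r * r - rs e by rewrite rr !rsD; ncring.
apply: le_trans (nmB _ _) _; rewrite nm_rs gtr0_norm //.
have := h _; have := nm_ge0 x; rewrite /e => x0 {}h.
by have /h : 0 <= T + e' / 3 + e' / 3; lra.
Qed.

Lemma npos0 : npos 0.
Proof. by split; [exact: star0 | exists 0; rewrite rs0 subrr nm0]. Qed.

Lemma npos_rs t : 0 <= t -> npos (rs t).
Proof. by split; [exact: star_rs | exists t; rewrite subrr nm0]. Qed.

Lemma nposD x y : npos x -> npos y -> npos (x + y).
Proof.
move=> [sx [T hT]] [sy [U hU]]; split; first by rewrite starD sx sy.
exists (T + U); rewrite rsD.
have -> : rs T + rs U - (x + y) = (rs T - x) + (rs U - y) by ncring.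
by apply: le_trans (nmD _ _) _; lra.
Qed.

Lemma npos_rsM t x : 0 <= t -> npos x -> npos (rs t * x).
Proof.
move=> t0 [sx [T hT]]; split; first by rewrite starM sx star_rs rsC.
exists (t * T); rewrite rsM -mulrBr nm_rsM ger0_norm //.
exact: ler_wpM2l.
Qed.

Lemma npos_nmB x T : star x = x -> nm x <= T -> npos (rs T - x).
Proof.
move=> sx xT; split; first by rewrite starB sx star_rs.
by exists T; have -> : rs T - (rs T - x) = x by ncring.
Qed.

Lemma npos_closed x :
  (forall e, 0 < e -> exists2 y : A, npos y & nm (y - x) < e) -> npos x.
Proof.
move=> h; split.
  by apply: selfadjoint_closed => e /h[y [sy _] hy]; exists y.
exists (nm x + 1); apply/ler_addgt0Pr => e e0.
pose d := Num.min e 1; have d0 : 0 < d by rewrite lt_min e0 ltr01.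
have de : d <= e by rewrite ge_min lexx.
have d1 : d <= 1 by rewrite ge_min lexx orbT.
have [y py hy] := h d d0.
have yx : nm y <= nm x + 1.
  by have := nm_triangle x y 0; rewrite !subr0; lra.
have := npos_nm py yx.
by have := nm_triangle y (rs (nm x + 1)) x; lra.
Qed.

End positivity.

(** * Spectral positivity, order and conjugation *)

Section positivity_theory.
Context {R : realType} {A : cstarAlgType R}.
Implicit Types (a b c k x y z u v w r s p q : A) (t e d T : R).

(** The roots [w] of [x + e] and [v] of [T - x + e] commute and their squares add up to [T + 2 e],
    which bounds [nm (w * w)]. *)
Lemma npos_nm_le x T : 0 <= T -> npos x -> npos (rs T - x) -> nm x <= T.
Proof.
move=> T0 px pT; apply/ler_addgt0Pr => e' e'0.
pose e := e' / 3; have e0 : 0 < e by rewrite /e; lra.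
have [w [nw ww cw]] := npos_sqrt px e0.
have [v [nv vv cv]] := npos_sqrt pT e0.
have wv : w * v = v * w.
  apply: cv; rewrite mulrBr mulrBl rsC; congr (_ - _).
  by rewrite -cw.
have Te : 0 <= T + (e + e) by lra.
have := nm_sqr_le_of_sum_sqr Te (npos_sa nw) (npos_sa nv) wv.
have -> : w * w + v * v = rs (T + (e + e)) by rewrite ww vv !rsD; ncring.
move=> /(_ erefl); rewrite ww => h.
have -> : x = x + rs e - rs e by ncring.
apply: le_trans (nmB _ _) _; rewrite nm_rs gtr0_norm //.
by move: h; rewrite /e; lra.
Qed.

(** Because [x <= y <= nm y] in the order of [A]. *)
Lemma npos_le_nm x y : npos x -> npos (y - x) -> nm x <= nm y.
Proof.
move=> px pyx; apply: npos_nm_le => //; first exact: nm_ge0.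
have py : npos y by have -> : y = x + (y - x); [ncring | exact: nposD].
have -> : rs (nm y) - x = (rs (nm y) - y) + (y - x) by ncring.
by apply: nposD => //; apply: npos_nmB => //; exact: npos_sa.
Qed.

(* [x - d] is the square of [r z] with [r^2 = x + d] and
   [z^2 = 1 - 2 d (x + d)^-1]. *)
Lemma npos_subr x : npos x -> cstar_invertible x ->
  exists2 d, 0 < d & npos (x - rs d).
Proof.
move=> px [y [yx xy]]; have y0 := nm_ge0 y.
pose m := nm y + 1; have m0 : 0 < m by rewrite /m; lra.
(* The choice [d * m = 1/8], with [nm k <= 2 * m] below, gives [2 * d * nm k <= 1/2 < 1], so that
   [z] exists. *)
pose d := (8 * m)^-1; have d0 : 0 < d by rewrite invr_gt0; lra.
have dm : d * m = 8^-1.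
  by rewrite /d invfM -mulrA mulVf ?mulr1 ?lt0r_neq0.
exists d => //.
have [k [kx xk]] := npos_addr_invertible px d0.
have sk : star k = k.
  by apply: (star_inverse xk kx); rewrite starD npos_sa // star_rs.
have nk : nm k <= 2 * m.
  (* The resolvent identity for the inverses [y] of [x] and [k] of [x + d]. *)
  have hk : k = y - rs d * (k * y).
    have -> : y - rs d * (k * y) = k * (x + rs d) * y - rs d * (k * y).
      by rewrite kx mul1r.
    have -> : k * (x + rs d) * y - rs d * (k * y) =
       k * (x * y) + (k * rs d - rs d * k) * y by ncring.
    by rewrite xy -rsC subrr mulr1 mul0r addr0.
  have := nmB y (rs d * (k * y)); rewrite -hk nm_rsM gtr0_norm //.
  have := nmM k y; have := nm_ge0 k; move: dm; rewrite /m.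
  move: (nm (k * y)) (nm k) (nm y) y0 => n1 n2 n3 *.
  have : d * n1 <= d * (n2 * n3) by apply: ler_wpM2l => //; lra.
  have -> : d * (n2 * n3) = n2 * (d * n3) by ring.
  have dn : d * n3 <= 8^-1 by nra.
  have : n2 * (d * n3) <= n2 * 8^-1 by apply: ler_wpM2l.
  by lra.
have [r [nr rr cr]] := npos_sqrt px d0.
have rx : r * (x + rs d) = (x + rs d) * r by rewrite -rr mulrA.
have rk := comm_inverse xk kx rx.
have [||z [nz zz cz]] := @npos_sqrt_compl R A (rs (2 * d) * k) 1.
- by rewrite starM sk star_rs rsC.
- rewrite nm_rsM ger0_norm; last lra.
  have : d * nm k <= d * (2 * m) by apply: ler_wpM2l => //; exact: ltW.
  by move: dm; move: (nm k) => n *; nra.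
have rz : r * z = z * r.
  by apply: cz; rewrite mulrA -rsC -!mulrA rk.
have -> : x - rs d = (r * z) * (r * z).
  have -> : (r * z) * (r * z) = (r * r) * (z * z) - r * (r * z - z * r) * z.
    by ncring.
  rewrite rz subrr mulr0 mul0r subr0 rr zz rs1 mulrBr mulr1.
  have -> : rs (2 * d) * k = k * rs (2 * d) by rewrite rsC.
  rewrite mulrA xk mul1r.
  have -> : 2 * d = d + d by ring.
  by rewrite !rsD; ncring.
by apply: npos_sqr; rewrite starM !npos_sa.
Qed.

Lemma npos_of_invertible x : star x = x ->
  (forall t, 0 < t -> cstar_invertible (x + rs t)) -> npos x.
Proof.
move=> sx ix.
pose E := [set t : R | 0 <= t /\ npos (x + rs t)].
have E0 : E (nm x).
  split; first exact: nm_ge0.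
  split; first by rewrite starD sx star_rs.
  exists (nm x); have -> : rs (nm x) - (x + rs (nm x)) = - x by ncring.
  by rewrite nmN.
have lE : has_lbound E by exists 0 => t [].
have iE : has_inf E by split; [exists (nm x) | ].
pose t0 := inf E.
have t00 : 0 <= t0 by apply: lb_le_inf; [exists (nm x) | move=> t []].
have pt0 : npos (x + rs t0).
  apply: npos_closed => e e0.
  have [t [tp pt] ht] := inf_adherent e0 iE.
  have tt : t0 <= t by exact: ge_inf.
  exists (x + rs t) => //.
  have -> : x + rs t - (x + rs t0) = rs (t - t0) by rewrite rsB; ncring.
  by rewrite nm_rs ger0_norm; move: ht; rewrite -/t0; lra.
case: (ltP 0 t0) => [t0p|t0n]; last first.
  have t0E : t0 = 0 by apply/eqP; rewrite eq_le t0n t00.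
  by move: pt0; rewrite t0E rs0 addr0.
have [d d0 pd] := npos_subr pt0 (ix t0 t0p).
(* Truncated at 0 to stay in the range of [E]; still [s < t0], against the choice of [t0] as the
   infimum. *)
pose s := Num.max 0 (t0 - d).
have Es : E s.
  split; first by rewrite le_max lexx.
  have -> : x + rs s = (x + rs t0 - rs d) + rs (s - (t0 - d)).
    by rewrite !rsB; ncring.
  by apply: nposD => //; apply: npos_rs; rewrite subr_ge0 le_max lexx orbT.
have : t0 <= s by exact: ge_inf.
by rewrite /s le_max => /orP[]; lra.
Qed.

(** Forward, no [- t] with [t > 0] lies in the spectrum, so every [x + t] is invertible. Backward, a
    negative real [al] is excluded by invertibility of [x - al]. For [al + i be] with [be] nonzero,
    put [y = x - al]: then [i be - y] is a commuting factor of [y * y + be ^+ 2], which is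
    invertible. *)
Lemma cstar_positiveE x : cstar_positive x <-> npos x.
Proof.
split=> [[sx px]|px].
  apply: npos_of_invertible => // t t0; apply: contrapT => h.
  have := px (- t%:C); rewrite oppr_ge0 lecR => tle.
  suff : t <= 0 by lra.
  apply: tle => /cstar_invertibleN.
  by rewrite opprB scaleNr opprK.
have sx := npos_sa px; split=> // -[al be] h; apply: contrapT => nc; apply: h.
have -> : (al +i* be)%:A = rs al + rs be * 'i%:A :> A.
  rewrite /rs -scalerAl mul1r scalerA -scalerDl; congr (_ *: _).
  by rewrite [LHS]complexE /= mulrC complexiE.
have iC a : 'i%:A * a = a * 'i%:A by rewrite -scalerAl -scalerAr mul1r mulr1.
have ii : 'i%:A * 'i%:A = -1 :> A.
  by rewrite -scalerAl mul1r scalerA -expr2 sqrCi scaleN1r.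
pose y := x - rs al.
have [be0|be0] := eqVneq be 0.
  rewrite be0 rs0 mul0r addr0.
  have al0 : al < 0.
    by rewrite ltNge; apply/negP => al0; apply: nc; rewrite be0 ler0c.
  have -> : rs al - x = - (x + rs (- al)) by rewrite rsN; ncring.
  by apply/cstar_invertibleN/npos_addr_invertible => //; lra.
have sy : star y = y by rewrite /y starB sx star_rs.
pose i : A := 'i%:A; pose c := rs be * i.
have cy : c * y = y * c by rewrite /c -mulrA iC mulrA rsC mulrA.
have cc : c * c = - rs (be ^+ 2).
  have -> : c * c =
    rs be * rs be * (i * i) + rs be * (i * rs be - rs be * i) * i.
    by rewrite /c; ncring.
  by rewrite /i ii iC subrr mulr0 mul0r addr0 mulrN1 expr2 rsM.
have -> : rs al + rs be * 'i%:A - x = c - y by rewrite /y /c; ncring.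
apply: (@cstar_invertible_factor _ _ _ (- y - c)).
  have -> : (c - y) * (- y - c) =
    (- y - c) * (c - y) - (c * y - y * c) - (c * y - y * c) by ncring.
  by rewrite cy subrr !subr0.
have -> : (c - y) * (- y - c) = y * y - c * c - (c * y - y * c) by ncring.
rewrite cy cc subrr subr0 opprK.
apply: npos_addr_invertible; first exact: npos_sqr.
by rewrite exprn_even_gt0.
Qed.

(** A root [g] of [r + d] commutes with [s], so [s * r * s] is a limit of the squares of the
    self-adjoint [g * s]. The general conjugation [npos_conj] rests on [npos_starM], whose proof
    uses this case. *)
Lemma npos_conj_comm r s : npos r -> star s = s -> r * s = s * r ->
  npos (s * r * s).
Proof.
move=> pr ss rsc; apply: npos_closed => e e0; have n0 := nm_ge0 (s * s).
pose d := e / (nm (s * s) + 1); have d0 : 0 < d by apply: divr_gt0; lra.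
have [g [pg gg cg]] := npos_sqrt pr d0.
have gs : s * g = g * s by apply: cg.
exists ((g * s) * (g * s)).
  by apply: npos_sqr; rewrite starM ss npos_sa.
have -> : g * s * (g * s) - s * r * s =
   (g * s - s * g) * g * s + s * (g * g - (r + rs d)) * s + s * (rs d * s)
   by ncring.
rewrite gs gg !subrr !mul0r mulr0 mul0r !add0r mulrA -rsC -mulrA.
by rewrite nm_rsM gtr0_norm // divr_mul_lt.
Qed.

(** The products [x * y] and [y * x] have the same nonzero spectrum: if [k] inverts [t - x * y],
    then [(1 + y * k * x) / t] inverts [t - y * x]. *)
Lemma cstar_invertible_swap x y t : t != 0 ->
  cstar_invertible (rs t - x * y) -> cstar_invertible (rs t - y * x).
Proof.
move=> t0 [k [kl kr]].
have kl' : k * (x * y) = rs t * k - 1 by rewrite -kl rsC; ncring.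
have kr' : x * y * k = rs t * k - 1 by rewrite -kr; ncring.
pose m := rs t^-1 * (1 + y * k * x).
apply: (@cstar_invertible_lr _ _ _ m m).
  rewrite /m -mulrA.
  have -> : (1 + y * k * x) * (rs t - y * x) =
     rs t - y * x + y * k * (x * rs t - rs t * x)
     + y * (k * rs t - rs t * k) * x
     - y * (k * (x * y) - (rs t * k - 1)) * x
     + y * x by ncring.
  by rewrite kl' !(rsC t) !subrr !mulr0 !mul0r !addr0 subr0 subrK
    -rsM mulVf // rs1.
rewrite /m mulrA -[(rs t - _) * rs _]rsC -mulrA.
have -> : (rs t - y * x) * (1 + y * k * x) =
     rs t - y * x + (rs t * y - y * rs t) * k * x
     - y * (x * y * k - (rs t * k - 1)) * x
     + y * x by ncring.
by rewrite kr' !(rsC t) !subrr !mulr0 !mul0r !addr0 subr0 subrK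
    -rsM mulVf // rs1.
Qed.

(** Up to sign, [d1] and [d2] are twice the real and imaginary parts of [c], and the sum is half of
    [d1 * d1 + d2 * d2]. *)
Lemma npos_starMD c : npos (star c * c + c * star c).
Proof.
pose i : A := 'i%:A.
have iC a : i * a = a * i by rewrite /i -scalerAl -scalerAr mul1r mulr1.
have ii : i * i = -1.
  by rewrite /i -scalerAl mul1r scalerA -expr2 sqrCi scaleN1r.
have si : star i = - i.
  rewrite /i starZ star1 -scaleNr; congr (_ *: _).
  exact: conjCi.
pose d1 := c + star c; pose d2 := i * (c - star c).
have p1 : npos (d1 * d1) by apply: npos_sqr; rewrite starD starK addrC.
have p2 : npos (d2 * d2).
  apply: npos_sqr; rewrite /d2 starM starB starK si mulrN -iC.
  by ncring.
have -> : star c * c + c * star c = rs 2^-1 * (d1 * d1 + d2 * d2).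
  have -> : d1 * d1 + d2 * d2 = rs 2 * (star c * c + c * star c).
    rewrite /d2 -mulrA [(c - _) * (_ * _)]mulrA -(iC (c - star c)).
    rewrite -mulrA mulrA ii.
    by rewrite /d1 (rsD 1 1) rs1; ncring.
  by rewrite mulrA rsVl ?mul1r // pnatr_eq0.
by apply: npos_rsM; [lra | exact: nposD].
Qed.

(* With [b = z* z], [r^2 = b^2 + e], [s = r - b] and [c = z s], one has
   [s^2 = 2 r s - e], so that [- c* c = s r s - e s] is almost positive; so is
   [- c c*], which has the same nonzero spectrum, while [c* c + c c*] is
   positive. Hence [c* c], [s r s], [s^3] and finally [r - b = s] are small. *)
Lemma npos_starM z : npos (star z * z).
Proof.
pose b := star z * z; have sb : star b = b by rewrite /b starM starK.
apply: npos_closed => e' e'0.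
(* The estimates end in [nm s ^+ 2 <= 9 * e], which is then less than [e' ^+ 2]. *)
pose e := e' ^+ 2 / 16; have e0 : 0 < e by rewrite divr_gt0 ?exprn_gt0.
have [r [pr rr cr]] := npos_sqrt (npos_sqr sb) e0.
have br : b * r = r * b by apply: cr; rewrite mulrA.
exists r => //; rewrite -/b; pose s := r - b; rewrite -/s.
have ss : star s = s by rewrite starB sb npos_sa.
have rsc : r * s = s * r by rewrite mulrBr mulrBl br.
have s2 : s * s = r * s + r * s - rs e.
  have -> : s * s = r * s + r * s - rs e + (r * b - b * r)
            - (r * r - (b * b + rs e)) by rewrite /s; ncring.
  by rewrite br rr !subrr subr0 addr0.
pose c := z * s.
have cc : star c * c = rs e * s - s * r * s.
  have -> : star c * c = s * b * s by rewrite starM ss /b !mulrA.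
  have -> : s * b * s = rs e * s - s * r * s
     + (s * r - r * s) * s + (s * r - r * s) * s 
     - (s * s - (r * s + r * s - rs e)) * s by rewrite /s; ncring.
  by rewrite -rsc s2 !subrr mul0r !addr0 subr0.
have n0 := nm_ge0 s.
pose eta := e * nm s; have eta0 : 0 <= eta by rewrite mulr_ge0 // ltW.
have psrs : npos (s * r * s) by exact: npos_conj_comm.
have pcc : npos (rs eta - star c * c).
  have -> : rs eta - star c * c = s * r * s + rs e * (rs (nm s) - s).
    by rewrite cc /eta rsM; ncring.
  apply: nposD => //; apply: npos_rsM; first exact: ltW.
  exact: npos_nmB.
have pcc' : npos (rs eta - c * star c).
  apply: npos_of_invertible => [|t t0].
    by rewrite starB star_rs starM starK.
  have -> : rs eta - c * star c + rs t = rs (eta + t) - c * star c.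
    by rewrite rsD; ncring.
  apply: cstar_invertible_swap; first by rewrite lt0r_neq0 //; lra.
  have -> : rs (eta + t) - star c * c = rs eta - star c * c + rs t.
    by rewrite rsD; ncring.
  exact: npos_addr_invertible.
have plow : npos (rs eta + star c * c).
  have -> : rs eta + star c * c =
    (star c * c + c * star c) + (rs eta - c * star c) by ncring.
  by apply: nposD => //; exact: npos_starMD.
have ncc : nm (star c * c) <= 3 * eta.
  have h : nm (rs eta + star c * c) <= eta + eta.
    apply: npos_nm_le => //; first lra.
    have -> // : rs (eta + eta) - (rs eta + star c * c) = rs eta - star c * c.
    by rewrite rsD; ncring.
  have -> : star c * c = rs eta + star c * c - rs eta by ncring.
  apply: le_trans (nmB _ _) _; rewrite nm_rs ger0_norm //; lra.
have nes : nm (rs e * s) = eta by rewrite nm_rsM gtr0_norm.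
have nsrs : nm (s * r * s) <= 4 * eta.
  have -> : s * r * s = rs e * s - star c * c by rewrite cc; ncring.
  by apply: le_trans (nmB _ _) _; lra.
have ns3 : nm (s * s * s) <= 9 * eta.
  have -> : s * s * s = s * r * s + s * r * s - rs e * s.
    by rewrite {1}s2 rsc; ncring.
  apply: le_trans (nmB _ _) _; have := nmD (s * r * s) (s * r * s); lra.
have n2 : nm (s * s) = nm s ^+ 2 by rewrite -nm_starM ss.
have n4 : nm (s * s * s * s) = nm s ^+ 4.
  have -> : s * s * s * s = star (s * s) * (s * s) by rewrite starM ss; ncring.
  by rewrite nm_starM n2 -exprM.
have h4 : nm s ^+ 4 <= 9 * e * nm s ^+ 2.
  rewrite -n4; apply: le_trans (nmM _ _) _.
  have -> : 9 * e * nm s ^+ 2 = 9 * eta * nm s by rewrite /eta; ring.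
  by apply: ler_wpM2r.
have [->|sp] := eqVneq (nm s) 0; first by [].
have {sp} sp : 0 < nm s by rewrite lt0r sp.
have {}h4 : nm s ^+ 2 <= 9 * e.
  move: h4; have -> : nm s ^+ 4 = nm s ^+ 2 * nm s ^+ 2 by ring.
  by rewrite ler_pM2r // exprn_gt0.
rewrite -(@ltr_pXn2r _ 2) ?nnegrE //; last exact: ltW.
apply: le_lt_trans h4 _; rewrite /e.
have : 0 < e' ^+ 2 by rewrite exprn_gt0.
lra.
Qed.

Lemma npos_Mstar z : npos (z * star z).
Proof. by rewrite -{1}[z]starK; exact: npos_starM. Qed.

(** With [g] a root of [p + d], the positive element [(w * g) * star (w * g)] differs from the
    conjugate of [p] by [d] times [w * star w]. *)
Lemma npos_conj p w : npos p -> npos (w * p * star w).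
Proof.
move=> pp; apply: npos_closed => e e0; have n0 := nm_ge0 (w * star w).
pose d := e / (nm (w * star w) + 1); have d0 : 0 < d by apply: divr_gt0; lra.
have [g [pg gg _]] := npos_sqrt pp d0.
exists ((w * g) * star (w * g)); first exact: npos_Mstar.
have -> : w * g * star (w * g) - w * p * star w = rs d * (w * star w).
  rewrite starM npos_sa // !mulrA -[w * g * g]mulrA gg mulrDr -rsC.
  by ncring.
by rewrite nm_rsM gtr0_norm // divr_mul_lt.
Qed.

End positivity_theory.

(** * Cauchy-Schwarz, uniform boundedness and majorization *)

Section hilbert_module.
Context {R : realType} {A : cstarAlgType R} {H : hilbertModType A}.
Implicit Types (f g x y : H) (a c : A) (t e C : R) (K L : adjointable H).

Lemma innerZl c f g : inner (c *: f) g = c * inner f g.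
Proof. by have := inner_linearl c f 0 g; rewrite !addr0 inner0l addr0. Qed.

Lemma innerZr c f g : inner f (c *: g) = inner f g * star c.
Proof. by rewrite -inner_star innerZl starM inner_star. Qed.

Lemma innerBl f g x : inner (f - g) x = inner f x - inner g x.
Proof. by rewrite innerDl innerNl. Qed.

Lemma innerBr f g x : inner x (f - g) = inner x f - inner x g.
Proof. by rewrite -inner_star innerBl starB !inner_star. Qed.

Lemma npos_inner f : npos (inner f f).
Proof. exact/cstar_positiveE/inner_ge0. Qed.

Lemma inner_ext f g : (forall x, inner x f = inner x g) -> f = g.
Proof.
move=> h; apply/eqP; rewrite -subr_eq0; apply/eqP/inner_eq0.
by rewrite innerBr h subrr.
Qed.

Lemma adj_funZ K c f : adj K (c *: f) = c *: adj K f.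
Proof. by apply: inner_ext => x; rewrite -adj_inner !innerZr adj_inner. Qed.

Definition hn f : R := Num.sqrt (nm (inner f f)).

Lemma hn_ge0 f : 0 <= hn f. Proof. exact: sqrtr_ge0. Qed.

Lemma sqr_hn f : hn f ^+ 2 = nm (inner f f).
Proof. by rewrite sqr_sqrtr // nm_ge0. Qed.

Lemma hilbert_normE f : hilbert_norm f = (hn f)%:C.
Proof.
by rewrite /hilbert_norm normE -sqr_hn rmorphXn /= sqrCK // ler0c hn_ge0.
Qed.

Lemma hnD f g : hn (f + g) <= hn f + hn g.
Proof.
have := hilbert_normD f g.
by rewrite -!/(hilbert_norm _) !hilbert_normE -rmorphD lecR.
Qed.

Lemma hnN f : hn (- f) = hn f.
Proof. by apply: complexI; rewrite -!hilbert_normE hilbert_normN. Qed.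

Lemma hn_triangle y x f : hn (x - f) <= hn (x - y) + hn (y - f).
Proof. by rewrite -[x - f](subrKA y) hnD. Qed.

Lemma hn_distC f g : hn (f - g) = hn (g - f).
Proof. by rewrite -hnN opprB. Qed.

Lemma hn_rsZ t f : hn (rs t *: f) = `|t| * hn f.
Proof.
rewrite /hn innerZl innerZr star_rs -rsC mulrA -rsM nm_rsM.
by rewrite -expr2 sqrtrM ?normr_ge0 // ger0_norm ?sqr_ge0 // sqrtr_sqr.
Qed.

(** With [N = nm (inner g g)] and [c = inner f g], the square of [N f - c g] plus the positive
    [c * (N - inner g g) * star c] equals [N] times the claimed element. If [N = 0] then [g = 0]. *)
Lemma inner_cauchy_schwarz f g :
  npos (rs (nm (inner g g)) * inner f f - inner f g * inner g f).
Proof.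
set N := nm (inner g g); have N0 : 0 <= N by exact: nm_ge0.
have [Nz|Nz] := eqVneq N 0.
  have -> : g = 0 by exact/inner_eq0/nm_eq0.
  by rewrite inner0l mulr0 subr0; apply: npos_rsM => //; exact: npos_inner.
have Np : 0 < N by rewrite lt0r Nz.
pose c := inner f g.
have sc : star c = inner g f by exact: inner_star.
have -> : rs N * inner f f - inner f g * inner g f =
  rs N^-1 * (inner (rs N *: f - c *: g) (rs N *: f - c *: g)
             + c * (rs N - inner g g) * star c).
  have -> : inner (rs N *: f - c *: g) (rs N *: f - c *: g)
             + c * (rs N - inner g g) * star c =
            rs N * (rs N * inner f f - c * inner g f).
    rewrite !(innerBl, innerBr, innerZl, innerZr) -/c star_rs -sc.
    have -> : rs N * (inner f f * rs N - c * star c)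
       - c * (star c * rs N - inner g g * star c)
       + c * (rs N - inner g g) * star c =
       rs N * (inner f f * rs N - c * star c)
       - c * (star c * rs N - rs N * star c) by ncring.
    by rewrite !(rsC N) subrr mulr0 subr0.
  by rewrite mulrA rsVl // mul1r.
apply: npos_rsM; first by rewrite invr_ge0.
apply: nposD; first exact: npos_inner.
by apply/npos_conj/npos_nmB => //; exact/npos_sa/npos_inner.
Qed.

Lemma nm_inner_le f g : nm (inner f g) <= hn f * hn g.
Proof.
rewrite -(@ler_pXn2r _ 2) ?nnegrE ?mulr_ge0 ?hn_ge0 ?nm_ge0 //.
rewrite exprMn !sqr_hn -nm_Mstar inner_star.
have h := inner_cauchy_schwarz f g.
have p : npos (inner f g * inner g f) by rewrite -inner_star; exact: npos_starM.
apply: le_trans (npos_le_nm p h) _.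
by rewrite nm_rsM ger0_norm ?nm_ge0 // mulrC.
Qed.

Lemma hn_complete (u : nat -> H) :
  (forall e, 0 < e -> exists n0, forall m n, (n0 <= m)%N -> (n0 <= n)%N ->
     hn (u m - u n) < e) ->
  exists l, forall e, 0 < e -> exists n0, forall n, (n0 <= n)%N ->
     hn (u n - l) < e.
Proof.
move=> hu; have [e e0|l hl] := @hilbert_complete R A H u.
  have [|n0 hn0] := hu (complex.Re e).
    by move: e0; rewrite ltcE => /andP[].
  exists n0 => m n hm hk; rewrite -/(hilbert_norm _) hilbert_normE.
  by rewrite -[e]RRe_real ?gtr0_real // ltcR hn0.
exists l => e e0; have [|n0 hn0] := hl e%:C; first by rewrite ltcR.
exists n0 => n hk; have := hn0 n hk.
by rewrite -/(hilbert_norm _) hilbert_normE ltcR.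
Qed.

(* The gliding-hump proof of uniform boundedness: every ball of radius [r]
   contains a point at which [inner _ g] has norm at least [r * hn g]. *)
Lemma hn_bounded_of_weakly_bounded (F : set H) :
  (forall x, exists C, forall g, F g -> nm (inner x g) <= C) ->
  exists C, forall g, F g -> hn g <= C.
Proof.
move=> wb; apply: contrapT => nb.
have big C : exists2 g, F g & C < hn g.
  apply: contrapT => h; apply: nb; exists C => g Fg.
  by rewrite leNgt; apply/negP => Cg; apply: h; exists g.
(* With ratio 1/4, all moves after stage [n] add up to at most [r n / 3]. The limit thus keeps two
   thirds of the value [r n * hn g >= 2 * n] reached at that stage, which exceeds any constant. *)
pose r n : R := 4^-1 ^+ n.
have r0 n : 0 < r n by rewrite exprn_gt0 // invr_gt0.
have step (p : nat * H) : exists x', hn (x' - p.2) <= r p.1 /\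
    exists g, [/\ F g, p.1%:R * 2 <= r p.1 * hn g &
                  r p.1 * hn g <= nm (inner x' g)].
  case: p => n x /=; have [g Fg] := big (n%:R * 2 / r n).
  rewrite ltr_pdivrMr // [hn g * _]mulrC => hg.
  have g0 : 0 < hn g.
    rewrite -(pmulr_rgt0 _ (r0 n)); apply: le_lt_trans hg.
    by rewrite mulr_ge0.
  pose d := rs (r n / hn g) *: g.
  have hd : hn d = r n.
    by rewrite hn_rsZ ger0_norm ?divr_ge0 ?ltW // mulfVK ?lt0r_neq0.
  have dg : nm (inner d g) = r n * hn g.
    rewrite innerZl nm_rsM ger0_norm ?divr_ge0 ?(ltW (r0 _)) ?(ltW g0) //.
    by rewrite -sqr_hn expr2 mulrA mulfVK ?lt0r_neq0.
  (* One of [x + d] and [x - d] works, since their inner products with [g] differ by twice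
     [inner d g], of norm [r n * hn g]. *)
  have [hx|hx] := leP (r n * hn g) (nm (inner (x + d) g)).
    exists (x + d); rewrite addrAC subrr add0r hd; split=> //.
    by exists g; split=> //; exact: ltW.
  exists (x - d); rewrite addrAC subrr add0r hnN hd; split=> //.
  exists g; split=> //; first exact: ltW.
  have : nm (inner d g + inner d g) <=
         nm (inner (x + d) g) + nm (inner (x - d) g).
    have -> : inner d g + inner d g = inner (x + d) g - inner (x - d) g.
      by rewrite innerBl innerDl; ncring.
    exact: nmB.
  have -> : inner d g + inner d g = rs 2 * inner d g.
    by rewrite (rsD 1 1) rs1; ncring.
  by rewrite nm_rsM dg ger0_norm //; lra.
have [phi hphi] := choice step.
pose u := fix u n := if n is m.+1 then phi (m, u m) else 0.
have rS n : r n.+1 = r n / 4 by rewrite /r exprS mulrC.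
have uu n k : hn (u (n + k)%N - u n) <= 4 / 3 * (r n - r (n + k)%N).
  elim: k => [|k IH].
    by rewrite addn0 !subrr mulr0 /hn inner0l nm0 sqrtr0.
  rewrite addnS; apply: le_trans (hn_triangle (u (n + k)%N) _ _) _.
  have [/= h _] := hphi ((n + k)%N, u (n + k)%N).
  by rewrite rS; lra.
have uu' n m : (n <= m)%N -> hn (u m - u n) <= 4 / 3 * r n.
  move=> nm_le; rewrite -(subnKC nm_le); apply: le_trans (uu _ _) _.
  by have := r0 (n + (m - n))%N; lra.
have [e e0|x hx] := @hn_complete u.
  have [||n0 hn0] := @exists_expr_lt R 4^-1 (e / 4); [lra | lra | ].
  exists n0 => m n /uu' hm /uu' hk.
  apply: le_lt_trans (hn_triangle (u n0) _ _) _.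
  rewrite [X in _ + X]hn_distC; move: hm hk; rewrite /r; lra.
have xu n : hn (x - u n) <= 4 / 3 * r n.
  apply/ler_addgt0Pr => e e0; have [n0 hn0] := hx e e0.
  apply: le_trans (hn_triangle (u (n + n0)%N) _ _) _.
  rewrite hn_distC; have := hn0 _ (leq_addl n n0).
  by have := uu' _ _ (leq_addr n0 n); lra.
have [C hC] := wb x.
pose n := Num.bound `|C|.
have nC : C < n%:R.
  by apply: le_lt_trans (ler_norm C) _; exact: archi_boundP.
have [/= _ [g [Fg ng hg]]] := hphi (n, u n).
have := hC g Fg; have := xu n.+1; rewrite rS /= => h1 h2.
have h3 := nm_inner_le (x - phi (n, u n)) g.
have h4 : nm (inner (phi (n, u n)) g) <=
          nm (inner x g) + nm (inner (x - phi (n, u n)) g).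
  have := nm_triangle (inner x g) (inner (phi (n, u n)) g) 0.
  by rewrite innerBl !subr0 nm_distC addrC.
have h5 : hn (x - phi (n, u n)) * hn g <= 4 / 3 * (r n / 4) * hn g.
  by apply: ler_wpM2r => //; exact: hn_ge0.
have h6 : 4 / 3 * (r n / 4) * hn g = 3^-1 * (r n * hn g) by field.
move: h6 h5 h4 h3 hg ng; move: (r n * hn g) => w.
move: (nm (inner (x - _) g)) (hn _ * hn g) (4 / 3 * _ * _) => w1 w2 w3.
have n0 : 0 <= n%:R :> R by [].
lra.
Qed.

(** A norm form of Douglas majorization. Weak boundedness holds because [L x = K y] for some [y],
    whence [inner x (adj L f) = inner y (adj K f)]. *)
Lemma hn_adj_le K L : range L `<=` range K ->
  exists2 C : R, 0 <= C & forall f, hn (adj L f) <= C * hn (adj K f).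
Proof.
move=> LK.
have [x|C hC] := @hn_bounded_of_weakly_bounded
  [set g | exists2 f, hn (adj K f) <= 1 & g = adj L f].
  have [y _ yx] : range K (L x) by apply: LK; exists x.
  exists (hn y) => _ [f f1 ->]; rewrite -adj_inner -yx adj_inner.
  by apply: le_trans (nm_inner_le _ _) _; rewrite ler_piMr ?hn_ge0.
have C0 : 0 <= C.
  apply: le_trans (hn_ge0 (adj L 0)) (hC _ _); exists 0 => //.
  by rewrite -(scale0r 0) adj_funZ scale0r /hn inner0l nm0 sqrtr0.
exists C => // f; apply/ler_addgt0Pr => e' e'0.
pose e := e' / (C + 1); have e0 : 0 < e by apply: divr_gt0; lra.
have Ce : e * C < e' by exact: divr_mul_lt.
have k0 := hn_ge0 (adj K f).
(* Normalizes [adj K f] to norm at most 1; the summand [e] covers [adj K f = 0]. *)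
pose t := (hn (adj K f) + e)^-1; have t0 : 0 < t by rewrite invr_gt0; lra.
have : hn (adj L (rs t *: f)) <= C.
  apply: hC; exists (rs t *: f) => //.
  by rewrite adj_funZ hn_rsZ gtr0_norm // /t mulrC ler_pdivrMr; lra.
rewrite adj_funZ hn_rsZ gtr0_norm // /t mulrC ler_pdivrMr; last lra.
by rewrite mulrDr [C * e]mulrC; lra.
Qed.

Lemma npos_of_nm_le (p q : H -> A) C : 0 <= C ->
  (forall f, npos (p f)) -> (forall f, npos (q f)) ->
  (forall c f, p (c *: f) = c * p f * star c) ->
  (forall c f, q (c *: f) = c * q f * star c) ->
  (forall f, nm (p f) <= C * nm (q f)) ->
  forall f, npos (rs C * q f - p f).
Proof.
move=> C0 pp pq pZ qZ pq_le f; apply: npos_closed => e' e'0.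
pose e := e' / (C + 1); have e0 : 0 < e by apply: divr_gt0; lra.
have [r [nr rr _]] := npos_sqrt (pq f) e0; have sr := npos_sa nr.
have [c [cr rc]] : cstar_invertible r.
  by apply: (@cstar_invertible_factor _ _ _ r) => //; rewrite rr;
     exact: npos_addr_invertible.
have sc : star c = c by exact: star_inverse rc cr sr.
have qc : c * q f * star c = 1 - rs e * (c * c).
  rewrite sc; have -> : c * q f * c = c * (q f + rs e) * c - c * rs e * c.
    by ncring.
  by rewrite -rr mulrA cr mul1r rc -rsC mulrA.
have nq : nm (q (c *: f)) <= 1.
  apply: npos_nm_le => //; rewrite qZ qc rs1.
  have -> : 1 - (1 - rs e * (c * c)) = rs e * (c * c) by ncring.
  by apply: npos_rsM; [exact: ltW | exact: npos_sqr].
have np : nm (p (c *: f)) <= C.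
  by apply: le_trans (pq_le _) _; rewrite ler_piMr.
(* Conjugating [C - p (c *: f)] by [r], the inverse of [c], undoes the scaling and yields
   [C * (q f + e) - p f]. *)
have := npos_conj r (npos_nmB (npos_sa (pp _)) np).
rewrite pZ sr sc.
have -> : r * (rs C - c * p f * c) * r =
   (r * rs C - rs C * r) * r + rs C * (r * r) - (r * c) * p f * (c * r).
  by ncring.
rewrite rc cr mul1r mulr1 -rsC subrr mul0r add0r rr => h.
exists (rs C * (q f + rs e) - p f) => //.
have -> : rs C * (q f + rs e) - p f - (rs C * q f - p f) = rs C * rs e.
  by ncring.
have Ce0 : 0 <= C * e by rewrite mulr_ge0 // ltW.
by rewrite -rsM nm_rs ger0_norm // mulrC divr_mul_lt.
Qed.

End hilbert_module.

(** * Convergence along finite subsets *)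

Section nets.
Context {R : realType} {A : cstarAlgType R} {J : choiceType}.
Implicit Types (u v : {fset J} -> A) (k l a b c : A) (e : R) (F : {fset J}).

Definition net_cvg u l := forall e, 0 < e -> exists F0, forall F,
  (F0 `<=` F)%fset -> nm (u F - l) < e.

Lemma net_cvgP u l : net_cvg u l <-> u @ totally --> l.
Proof.
split=> [h|/cvgrPdist_lt h e e0].
  apply/cvgrPdist_lt => e e0; have [|F0 hF] := h (complex.Re e).
    by move: e0; rewrite ltcE => /andP[].
  exists F0 => // F /hF.
  by rewrite distrC normE -ltcR [(complex.Re e)%:C]RRe_real ?gtr0_real.
have [|F0 _ hF] := h e%:C; first by rewrite ltcR.
by exists F0 => F /hF; rewrite distrC normE ltcR.
Qed.

Lemma net_cvgD u v k l : net_cvg u k -> net_cvg v l ->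
  net_cvg (fun F => u F + v F) (k + l).
Proof.
move=> hu hv e e0; have [|F1 h1] := hu (e / 2); first lra.
have [|F2 h2] := hv (e / 2); first lra.
exists (F1 `|` F2)%fset => F; rewrite fsubUset => /andP[/h1 {}h1 /h2 {}h2].
have -> : u F + v F - (k + l) = (u F - k) + (v F - l) by ncring.
by apply: le_lt_trans (nmD _ _) _; lra.
Qed.

Lemma net_cvgM u l a b :
  net_cvg u l -> net_cvg (fun F => a * u F * b) (a * l * b).
Proof.
move=> hu e e0; have a0 := nm_ge0 a; have b0 := nm_ge0 b.
have ab0 : 0 <= nm a * nm b by exact: mulr_ge0.
have [|F0 h] := hu (e / (nm a * nm b + 1)); first by apply: divr_gt0; lra.
exists F0 => F /h {}h.
have -> : a * u F * b - a * l * b = a * (u F - l) * b by ncring.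
apply: le_lt_trans (divr_mul_lt e0 ab0).
apply: le_trans (nmM _ _) _.
apply: (@le_trans _ _ (nm a * nm (u F - l) * nm b)).
  by apply: ler_wpM2r => //; exact: nmM.
have -> : nm a * nm (u F - l) * nm b = nm (u F - l) * (nm a * nm b) by ring.
apply: ler_wpM2r => //.
exact: ltW.
Qed.

Lemma net_cvgN u l : net_cvg u l -> net_cvg (fun F => - u F) (- l).
Proof.
move=> hu e e0; have [F0 h] := hu e e0; exists F0 => F /h.
by rewrite -nmN opprD opprK.
Qed.

Lemma net_cvg_npos u l : (forall F, npos (u F)) -> net_cvg u l -> npos l.
Proof.
move=> pu hu; apply: npos_closed => e /hu[F0 h].
by exists (u F0) => //; exact: h.
Qed.

(** Completeness concerns sequences, so sets [G n] with tolerance [2^-n] are chosen. They need not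
    increase: two of them are compared through their union. *)
Lemma net_cauchy_cvg u :
  (forall e, 0 < e -> exists F0, forall F, (F0 `<=` F)%fset ->
     nm (u F - u F0) < e) ->
  exists l, net_cvg u l.
Proof.
move=> hu.
pose r n : R := 2^-1 ^+ n.
have r0 n : 0 < r n by rewrite exprn_gt0 // invr_gt0.
have [G hG] := choice (fun n => hu (r n) (r0 n)).
have r_le m n : (m <= n)%N -> r n <= r m.
  by move=> mn; apply: ler_wiXn2l => //; lra.
have small e : 0 < e -> exists n, r n < e.
  by move=> e0; apply: exists_expr_lt => //; lra.
have GG m n : nm (u (G m) - u (G n)) < r m + r n.
  apply: le_lt_trans (nm_triangle (u (G m `|` G n)%fset) _ _) _.
  by rewrite nm_distC ltrD // hG // ?fsubsetUl ?fsubsetUr.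
have [e e0|l hl] := @nm_complete R A (fun n => u (G n)).
  have [|n0 hn] := small (e / 2); first lra.
  exists n0 => m n /r_le hm /r_le hk; have := GG m n; lra.
exists l => e e0.
have [|n hn] := small (e / 4); first lra.
have [|n0 hn0] := hl (e / 4); first lra.
exists (G n) => F /hG hF.
apply: le_lt_trans (nm_triangle (u (G n)) _ _) _.
have := nm_triangle (u (G (maxn n n0))) (u (G n)) l.
have := GG n (maxn n n0); have := hn0 _ (leq_maxr n n0).
have := r_le _ _ (leq_maxl n n0); lra.
Qed.

Lemma partial_sumE (t : J -> A) F : partial_sum t F = \sum_(j <- F) t j.
Proof. by rewrite /partial_sum big_seq_fsetE. Qed.

Lemma npos_partial_sum (t : J -> A) F :
  (forall j, npos (t j)) -> npos (partial_sum t F).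
Proof.
move=> pt; rewrite partial_sumE; apply: big_ind => //.
  exact: npos0.
exact: nposD.
Qed.

Lemma npos_partial_sumB (t : J -> A) F G : (forall j, npos (t j)) ->
  (F `<=` G)%fset -> npos (partial_sum t G - partial_sum t F).
Proof.
move=> pt FG; rewrite !partial_sumE.
(* Extension by 0 turns both partial sums into sums over [G]. *)
pose t' j := if j \in F then t j else 0.
have -> : \sum_(j <- F) t j = \sum_(j <- G) t' j.
  rewrite -(big_fset_incl _ FG) => [|j _ /negbTE jF]; last by rewrite /t' jF.
  by apply: eq_big_seq => j jF; rewrite /t' jF.
rewrite -sumrB; apply: big_ind => [|x y|j _]; [exact: npos0 | exact: nposD |].
by rewrite /t'; case: ifP => _; rewrite ?subrr ?subr0 //; exact: npos0.
Qed.

End nets.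

(** * Frame sums and norm bounds for frames *)

Section frame_sums.
Context {R : realType} {A : cstarAlgType R} {H : hilbertModType A}.
Context {J : countType}.
Implicit Types (f x : H) (g h : J -> H) (c : A) (C : R) (K L : adjointable H).

Lemma frame_sumP g f : frame_cvg g f ->
  net_cvg (partial_sum (frame_term g f)) (frame_sum g f).
Proof. by move=> h; apply/net_cvgP. Qed.

Lemma net_cvg_frame g f l : net_cvg (partial_sum (frame_term g f)) l ->
  frame_cvg g f /\ frame_sum g f = l.
Proof.
move=> /net_cvgP h; split; first by apply/cvg_ex; exists l.
apply: cvg_lim => //; exact: norm_hausdorff.
Qed.

Lemma npos_frame_term g f j : npos (frame_term g f j).
Proof.
by rewrite /frame_term -[inner (g j) f]inner_star; exact: npos_Mstar.
Qed.

Lemma npos_frame_sum g f : frame_cvg g f -> npos (frame_sum g f).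
Proof.
move=> /frame_sumP; apply: net_cvg_npos => F.
by apply: npos_partial_sum => j; exact: npos_frame_term.
Qed.

(** The quadratic homogeneity that [npos_of_nm_le] asks of frame sums. *)
Lemma frame_sumZ g c f : frame_cvg g f ->
  frame_sum g (c *: f) = c * frame_sum g f * star c.
Proof.
move=> /frame_sumP /(@net_cvgM _ _ _ _ _ c (star c)) h.
suff /net_cvg_frame[] : net_cvg (partial_sum (frame_term g (c *: f)))
  (c * frame_sum g f * star c) by [].
rewrite (_ : partial_sum _ =
  fun F => c * partial_sum (frame_term g f) F * star c) //.
apply/funext => F; rewrite !partial_sumE mulr_sumr mulr_suml.
by apply: eq_bigr => j _; rewrite /frame_term innerZl innerZr !mulrA.
Qed.

Definition frame_defect g h f j : A :=
  frame_term g f j + frame_term g f j + (frame_term h f j + frame_term h f j)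
  - frame_term (fun i => g i - h i) f j.

(* The defect is the term [|<f, g j + h j>|^2] of the parallelogram law. *)
Lemma npos_frame_defect g h f j : npos (frame_defect g h f j).
Proof.
have -> : frame_defect g h f j = frame_term (fun i => g i + h i) f j.
  rewrite /frame_defect /frame_term !(innerBl, innerBr, innerDl).
  have -> : inner f (g j + h j) = inner f (g j) + inner f (h j).
    by rewrite -[LHS]inner_star innerDl starD !inner_star.
  by ncring.
exact: npos_frame_term.
Qed.

Lemma partial_sum_defect g h f (F : {fset J}) :
  partial_sum (frame_defect g h f) F =
  partial_sum (frame_term g f) F + partial_sum (frame_term g f) F
  + (partial_sum (frame_term h f) F + partial_sum (frame_term h f) F)
  - partial_sum (frame_term (fun i => g i - h i) f) F.
Proof. by rewrite !partial_sumE -!big_split /= -sumrB. Qed.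

(** The partial sums of [frame_defect] are positive, hence so is their limit; [npos_le_nm] passes to
    norms. *)
Lemma nm_frame_sum_sub g h f : frame_cvg g f -> frame_cvg h f ->
  frame_cvg (fun j => g j - h j) f ->
  nm (frame_sum (fun j => g j - h j) f) <=
    2 * nm (frame_sum g f) + 2 * nm (frame_sum h f).
Proof.
move=> cg ch cd.
have pd : npos (frame_sum g f + frame_sum g f
    + (frame_sum h f + frame_sum h f) - frame_sum (fun j => g j - h j) f).
  have gs := frame_sumP cg; have hs := frame_sumP ch; have ds := frame_sumP cd.
  apply: net_cvg_npos
    (net_cvgD (net_cvgD (net_cvgD gs gs) (net_cvgD hs hs)) (net_cvgN ds)) => F.
  rewrite -partial_sum_defect; apply: npos_partial_sum => j.
  exact: npos_frame_defect.
have := npos_le_nm (npos_frame_sum cd) pd.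
have := nmD (frame_sum g f + frame_sum g f) (frame_sum h f + frame_sum h f).
have := nmD (frame_sum g f) (frame_sum g f).
have := nmD (frame_sum h f) (frame_sum h f).
lra.
Qed.

(** A Cauchy argument: by positivity of the defect, an increment of the partial sums for [g - h] is
    dominated by twice those for [g] and [h]. *)
Lemma frame_cvg_sub g h f : frame_cvg g f -> frame_cvg h f ->
  frame_cvg (fun j => g j - h j) f.
Proof.
move=> /frame_sumP cg /frame_sumP ch.
suff [l /net_cvg_frame[]] :
  exists l, net_cvg (partial_sum (frame_term (fun j => g j - h j) f)) l by [].
apply: net_cauchy_cvg => e e0.
(* Each of the two increments is below [e / 8] and counts twice, for a total below [e / 2]. *)
have [|F1 h1] := cg (e / 16); first lra.
have [|F2 h2] := ch (e / 16); first lra.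
exists (F1 `|` F2)%fset => F sF.
have := npos_partial_sumB (npos_frame_defect g h f) sF.
have := npos_partial_sumB (npos_frame_term (fun j => g j - h j) f) sF.
have sF1 : (F1 `<=` F)%fset by apply: fsubset_trans sF; exact: fsubsetUl.
have sF2 : (F2 `<=` F)%fset by apply: fsubset_trans sF; exact: fsubsetUr.
have := h1 _ sF1; have := h2 _ sF2.
have := h1 _ (fsubsetUl F1 F2); have := h2 _ (fsubsetUr F1 F2).
rewrite !partial_sum_defect.
set d := partial_sum (frame_term (fun j => g j - h j) f).
set s := partial_sum (frame_term g f); set t := partial_sum (frame_term h f).
set G := (F1 `|` F2)%fset; move=> k1 k2 k3 k4 pd.
pose m (x y : A) : A := x + x + (y + y).
have -> : m (s F) (t F) - d F - (m (s G) (t G) - d G) =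
  m (s F - s G) (t F - t G) - (d F - d G) by rewrite /m; ncring.
move=> /(npos_le_nm pd) /le_lt_trans; apply.
have := nm_triangle (frame_sum g f) (s F) (s G).
have := nm_triangle (frame_sum h f) (t F) (t G).
rewrite (nm_distC (frame_sum g f)) (nm_distC (frame_sum h f)).
have := nmD (s F - s G + (s F - s G)) (t F - t G + (t F - t G)).
have := nmD (s F - s G) (s F - s G); have := nmD (t F - t G) (t F - t G).
rewrite -/(m _ _); lra.
Qed.

Lemma strictly_nonzeroE (a : A) : strictly_nonzero a <-> cstar_invertible a.
Proof.
rewrite /strictly_nonzero /spectrum /= scale0r sub0r; split=> [h|h].
  by rewrite -[a]opprK; apply: cstar_invertibleN; exact: contrapT.
by apply; exact: cstar_invertibleN.
Qed.

Lemma strictly_nonzero_rs t : 0 < t -> strictly_nonzero (rs t : A).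
Proof.
move=> t0; apply/strictly_nonzeroE; exists (rs t^-1).
by rewrite rsVl ?rsVr ?lt0r_neq0.
Qed.

Lemma star_frame_upper K g a b : star_frame_bounds K g a b ->
  forall f, nm (frame_sum g f) <= nm b ^+ 2 * hn f ^+ 2.
Proof.
move=> [_ _ hb] f; have [cg _ /cstar_positiveE ub] := hb f.
apply: le_trans (npos_le_nm (npos_frame_sum cg) ub) _.
apply: le_trans (nmM _ _) _; rewrite nm_star sqr_hn expr2 mulrAC.
by apply: ler_wpM2r; [exact: nm_ge0 | exact: nmM].
Qed.

(** Strict nonvanishing makes [a] invertible, and conjugation by its inverse [k] recovers the inner
    product from the lower bound. The constant uses [nm k + 1] to be visibly positive. *)
Lemma star_frame_lower K g a b : star_frame_bounds K g a b ->
  exists2 C : R, 0 < C & forall f, hn (adj K f) ^+ 2 <= C * nm (frame_sum g f).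
Proof.
move=> [/strictly_nonzeroE[k [ka ak]] _ hb].
have k0 := nm_ge0 k.
exists ((nm k + 1) ^+ 2) => [|f]; first by rewrite exprn_gt0 //; lra.
have [cg /cstar_positiveE lb _] := hb f.
set p := inner (adj K f) (adj K f) in lb *.
have pp : npos p by exact: npos_inner.
have := npos_le_nm (npos_conj a pp) lb => h.
have sak : star a * star k = 1 by rewrite -starM ka star1.
rewrite sqr_hn -/p.
have -> : p = k * (a * p * star a) * star k.
  by rewrite !mulrA ka mul1r -mulrA sak mulr1.
apply: le_trans (nmM _ _) _; rewrite nm_star.
apply: (@le_trans _ _ (nm k * nm (a * p * star a) * nm k)).
  by apply: ler_wpM2r => //; exact: nmM.
have -> : nm k * nm (a * p * star a) * nm k = nm k ^+ 2 * nm (a * p * star a).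
  by ring.
apply: ler_pM => //; rewrite ?sqr_ge0 ?nm_ge0 //.
by rewrite lerXn2r ?nnegrE //; lra.
Qed.

End frame_sums.

(** * From norm inequalities to frames, and the perturbation criterion *)

Section perturbation.
Context {R : realType} {A : cstarAlgType R} {H : hilbertModType A}.
Context {J : countType}.
Implicit Types (x : H) (g h : J -> H) (M U V : R) (K L : adjointable H).

Lemma frame_termN g x : frame_term (fun j => - g j) x = frame_term g x.
Proof.
apply/funext => j; rewrite /frame_term innerNl -[inner x (- _)]inner_star.
by rewrite innerNl star_opp inner_star mulrNN.
Qed.

Lemma perturbation_boundE g h M : perturbation_bound g h M <->
  forall x, [/\ frame_cvg g x, frame_cvg h x, frame_cvg (fun j => g j - h j) x &
    nm (frame_sum (fun j => g j - h j) x) <=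
      M * Num.min (nm (frame_sum g x)) (nm (frame_sum h x))].
Proof.
have minC (s t : R) : Num.min s%:C t%:C = (Num.min s t)%:C.
  by rewrite /Order.min ltcR; case: ifP.
by split=> hM x; have [? ? ?] := hM x; rewrite !normE minC -rmorphM lecR.
Qed.

(** Both norm bounds become inequalities in [A] by [npos_of_nm_le], so scalar frame bounds
    suffice. *)
Lemma is_star_frame_of_nm_le L h U V : 0 <= U -> 0 <= V ->
  (forall x, frame_cvg h x) ->
  (forall x, nm (frame_sum h x) <= U * hn x ^+ 2) ->
  (forall x, hn (adj L x) ^+ 2 <= V * nm (frame_sum h x)) ->
  is_star_frame L h.
Proof.
move=> U0 V0 ch hU hV.
(* Frame bounds enter through their squares, hence the roots; the added 1 makes them invertible even
   if [U] or [V] is 0. *)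
pose al := Num.sqrt (V + 1)^-1; pose be := Num.sqrt (U + 1).
have al2 : al * al = (V + 1)^-1.
  by rewrite -expr2 sqr_sqrtr // invr_ge0; lra.
have be2 : be * be = U + 1 by rewrite -expr2 sqr_sqrtr; lra.
have pI x : npos (inner x x) by exact: npos_inner.
have pS x : npos (frame_sum h x) by exact: npos_frame_sum.
have IZ c x : inner (c *: x) (c *: x) = c * inner x x * star c.
  by rewrite innerZl innerZr mulrA.
have SZ c x : frame_sum h (c *: x) = c * frame_sum h x * star c.
  exact: frame_sumZ.
have LZ c x : inner (adj L (c *: x)) (adj L (c *: x)) =
    c * inner (adj L x) (adj L x) * star c by rewrite adj_funZ IZ.
have conjE t (y : A) : rs t * y * star (rs t) = rs (t * t) * y.
  by rewrite star_rs -mulrA -rsC mulrA rsM.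
exists (rs al), (rs be); split=> [||x].
- by apply: strictly_nonzero_rs; rewrite sqrtr_gt0 invr_gt0; lra.
- by apply: strictly_nonzero_rs; rewrite sqrtr_gt0; lra.
split=> //; apply/cstar_positiveE; rewrite conjE ?al2 ?be2.
- set y := inner _ _.
  have pxV : npos (rs V * frame_sum h x - y).
    apply: (npos_of_nm_le V0 _ pS LZ SZ) => z; first exact: npos_inner.
    by rewrite -sqr_hn.
  have -> : frame_sum h x - rs (V + 1)^-1 * y =
      rs (V + 1)^-1 * ((rs V * frame_sum h x - y) + frame_sum h x).
    have -> : rs V * frame_sum h x - y + frame_sum h x =
        rs (V + 1) * frame_sum h x - y by rewrite rsD rs1; ncring.
    by rewrite mulrBr mulrA rsVl ?mul1r // lt0r_neq0 //; lra.
  by apply: npos_rsM; [rewrite invr_ge0; lra | exact: nposD].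
- have -> : rs (U + 1) * inner x x - frame_sum h x =
    (rs U * inner x x - frame_sum h x) + inner x x by rewrite rsD rs1; ncring.
  apply: nposD => //; apply: (npos_of_nm_le U0 pS pI SZ IZ) => z.
  by rewrite -sqr_hn.
Qed.

(** Writing [h = g - (g - h)] and [g = (g - h) - (- h)], and using one side of the minimum each
    time, the norms of the two frame sums are comparable with factor [2 + 2 * M]. The bounds of [g]
    then transfer to [h], with [hn_adj_le] replacing [K] by [L]. *)
Lemma is_star_frame_perturbation K L g h a b M : range L `<=` range K ->
  star_frame_bounds K g a b -> 0 < M -> perturbation_bound g h M ->
  is_star_frame L h.
Proof.
move=> LK frame_g M0 /perturbation_boundE hM.
have [c c0 hc] := hn_adj_le LK.
have [C C0 hC] := star_frame_lower frame_g.
have ch x : frame_cvg h x by have [] := hM x.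
have nm_h x : nm (frame_sum h x) <= (2 + 2 * M) * nm (frame_sum g x).
  have [cg _ cd le_d] := hM x.
  have hE : h = (fun j => g j - (g j - h j)).
    by apply/funext => j; rewrite opprB addrC subrK.
  have := @nm_frame_sum_sub _ _ _ _ g (fun j => g j - h j) x cg cd.
  rewrite -hE => /(_ (ch x)).
  have : M * Num.min (nm (frame_sum g x)) (nm (frame_sum h x)) <=
         M * nm (frame_sum g x) by rewrite ler_pM2l // ge_min lexx.
  lra.
have nm_g x : nm (frame_sum g x) <= (2 + 2 * M) * nm (frame_sum h x).
  have [cg _ cd le_d] := hM x.
  have gE : g = (fun j => (g j - h j) - (- h j)).
    by apply/funext => j; rewrite opprK subrK.
  have := @nm_frame_sum_sub _ _ _ _ (fun j => g j - h j) (fun j => - h j) x cd.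
  have cN : frame_cvg (fun j => - h j) x.
    by rewrite /frame_cvg frame_termN; exact: ch.
  have sN : frame_sum (fun j => - h j) x = frame_sum h x.
    by rewrite /frame_sum frame_termN.
  rewrite -gE sN => /(_ cN cg).
  have : M * Num.min (nm (frame_sum g x)) (nm (frame_sum h x)) <=
         M * nm (frame_sum h x) by rewrite ler_pM2l // ge_min lexx orbT.
  lra.
apply: (@is_star_frame_of_nm_le L h ((2 + 2 * M) * nm b ^+ 2)
  (c ^+ 2 * C * (2 + 2 * M))) => // [||x|x].
- by rewrite mulr_ge0 ?sqr_ge0 //; lra.
- by rewrite !mulr_ge0 ?sqr_ge0 ?(ltW C0) //; lra.
- apply: le_trans (nm_h x) _; rewrite -mulrA ler_pM2l; last lra.
  exact: star_frame_upper frame_g x.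
- apply: (@le_trans _ _ ((c * hn (adj K x)) ^+ 2)).
    by rewrite lerXn2r ?nnegrE ?mulr_ge0 ?hn_ge0.
  rewrite exprMn -[leRHS]mulrA -[leRHS]mulrA ler_wpM2l ?sqr_ge0 //.
  by apply: le_trans (hC x) _; rewrite ler_pM2l.
Qed.

(** A co-isometry satisfies [hn x = hn (adj K x)], so both lower frame bounds, the one of [h]
    through [hn_adj_le], control [hn x ^+ 2]. The upper bounds control the sum for [g - h] by
    [hn x ^+ 2]. *)
Lemma perturbation_of_star_frames K L g h a b : co_isometry K ->
  range K `<=` range L -> star_frame_bounds K g a b -> is_star_frame L h ->
  exists2 M : R, 0 < M & perturbation_bound g h M.
Proof.
move=> coK KL frame_g [a' [b' frame_h]].
have [c c0 hc] := hn_adj_le KL.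
have [C C0 hC] := star_frame_lower frame_g.
have [D D0 hD] := star_frame_lower frame_h.
have ub_g := star_frame_upper frame_g; have ub_h := star_frame_upper frame_h.
have hnK x : hn x = hn (adj K x) by rewrite /hn -adj_inner coK.
have lb_g x : hn x ^+ 2 <= C * nm (frame_sum g x) by rewrite hnK.
have lb_h x : hn x ^+ 2 <= c ^+ 2 * D * nm (frame_sum h x).
  apply: (@le_trans _ _ ((c * hn (adj L x)) ^+ 2)).
    by rewrite hnK lerXn2r ?nnegrE ?mulr_ge0 ?hn_ge0.
  by rewrite exprMn -mulrA ler_wpM2l ?sqr_ge0.
pose B := 2 * nm b ^+ 2 + 2 * nm b' ^+ 2.
(* A sum of the two lower constants, valid whichever frame sum attains the minimum. *)
pose E := C + c ^+ 2 * D.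
have B0 : 0 <= B.
  by rewrite /B; have := sqr_ge0 (nm b); have := sqr_ge0 (nm b'); lra.
have cD0 : 0 <= c ^+ 2 * D by rewrite mulr_ge0 ?sqr_ge0 ?ltW.
have E0 : 0 < E by rewrite /E; lra.
exists ((B + 1) * E); first by rewrite mulr_gt0 //; lra.
apply/perturbation_boundE => x.
have cg : frame_cvg g x by have [_ _ /(_ x)[]] := frame_g.
have ch : frame_cvg h x by have [_ _ /(_ x)[]] := frame_h.
have cd := frame_cvg_sub cg ch.
split=> //; apply: le_trans (nm_frame_sum_sub cg ch cd) _.
set m := Num.min _ _.
have xm : hn x ^+ 2 <= E * m.
  have g0 := nm_ge0 (frame_sum g x); have h0 := nm_ge0 (frame_sum h x).
  have m0 : 0 <= m by rewrite le_min g0 h0.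
  have Cm : 0 <= C * m by rewrite mulr_ge0 // ltW.
  have Dm : 0 <= c ^+ 2 * D * m by rewrite mulr_ge0.
  rewrite /E mulrDl.
  have [mE|mE] : m = nm (frame_sum g x) \/ m = nm (frame_sum h x).
    by rewrite /m /Order.min; case: ifP; [left | right].
  - by have := lb_g x; rewrite -mE; lra.
  - by have := lb_h x; rewrite -mE; lra.
apply: (@le_trans _ _ (B * hn x ^+ 2)).
  by have := ub_g x; have := ub_h x; rewrite /B; lra.
rewrite -mulrA.
have : B * hn x ^+ 2 <= B * (E * m) by rewrite ler_wpM2l.
have : 0 <= E * m by apply: le_trans xm; exact: sqr_ge0.
lra.
Qed.

End perturbation.

Theorem theorem5p1 (R : realType) (A : cstarAlgType R) (H : hilbertModType A)
    (J : countType) (K L : adjointable H) (f h : J -> H) (a b : A)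
    (genH : finitely_generated H \/ countably_generated H)
    (rangeLK : range L `<=` range K)
    (closedK : closed (range K))
    (frame_f : star_frame_bounds K f a b) :
  ((exists2 M : R, 0 < M & perturbation_bound f h M) -> is_star_frame L h)
  /\
  (co_isometry K -> range K `<=` range L -> closed (range L) ->
   is_star_frame L h ->
   exists2 M : R, 0 < M & perturbation_bound f h M).
Proof.
split=> [[M M0 hM]|coK KL _ frame_h].
  exact: is_star_frame_perturbation rangeLK frame_f M0 hM.
exact: perturbation_of_star_frames coK KL frame_f frame_h.
Qed.
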